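(* Let $A$ and $C$ be finite-dimensional quantum systems of the same dimension $d$, and $B$ a finite-dimensional system. For any pure state $\psi_{ABC}$ such that $\rho_{AC}=\operatorname{tr}_B\psi_{ABC}$ is supported either on the symmetric or on the antisymmetric subspace of $\mathcal{H}_A\otimes\mathcal{H}_C$, we have $$S(\rho_A)\le\Delta(\psi)\le 2S(\rho_A).$$
   Context: $S$ is the von Neumann entropy (binary logarithm) and $\rho_A$ the reduced state of $\psi$ on $A$. A quantum Markov state on a tripartite system $XYZ$ is a state $\mu_{XYZ}$ for which there exist an orthogonal direct sum decomposition $\mathcal H_Y=\bigoplus_j b_j^L\otimes b_j^R$, a probability distribution $(p_j)$ and states $\mu^{(j)}_{Xb_j^L}$, $\mu^{(j)}_{b_j^RZ}$ with $\mu_{XYZ}=\bigoplus_j p_j\,\mu^{(j)}_{Xb_j^L}\otimes\mu^{(j)}_{b_j^RZ}$. $\Delta(\psi)=\inf D(\psi\|\mu)$, the infimum over all finite-dimensional systems $\widehat A\supseteq A$, $\widehat B\supseteq B$, $\widehat C\supseteq C$ (isometric embeddings, with $\psi$ regarded as a state on $\widehat A\widehat B\widehat C$) and all quantum Markov states $\mu$ on $\widehat A\widehat B\widehat C$, where $D(\rho\|\mu)=\operatorname{tr}\rho(\log\rho-\log\mu)$ is the quantum relative entropy. *)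

(* Defs.v *)
(* MathComp + MathComp-Analysis (realType, ln, extended reals,
   ereal_inf) + mathcomp-real-closed (complex numbers R[i]). *)
From mathcomp Require Import all_boot all_algebra.
From mathcomp Require Import all_classical all_reals all_analysis.
From mathcomp Require Import complex.
Import GRing.Theory Num.Theory ComplexField.

Set Implicit Arguments.
Unset Strict Implicit.
Unset Printing Implicit Defensive.

Local Open Scope ring_scope.

(* Finite-dimensional quantum mechanics.                                     *)
(* A finite-dimensional Hilbert space is C^T for a finite type T (the        *)
(* computational basis); a bipartite space C^T1 (x) C^T2 is C^(T1 * T2).     *)
(* A linear map C^U -> C^T is given by its matrix  M : T -> U -> C,          *)
(* M x y = <x| M |y>.  C = R[i] for an arbitrary real field R : realType.     *)

Section Quantum.
Variable R : realType.
Local Notation C := R[i].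

Definition mx (T U : finType) := T -> U -> C.
Definition vec (T : finType) := T -> C.

Definition mxmul (T U V : finType) (A : mx T U) (B : mx U V) : mx T V :=
  fun x z => \sum_(y : U) A x y * B y z.

(* Hermitian adjoint *)
Definition adj (T U : finType) (A : mx T U) : mx U T :=
  fun y x => ((A x y)^*)%C.

Definition idmx (T : finType) : mx T T := fun x y => (x == y)%:R.

Definition trace (T : finType) (A : mx T T) : C := \sum_(x : T) A x x.

Definition apply (T U : finType) (A : mx T U) (v : vec U) : vec T :=
  fun x => \sum_(y : U) A x y * v y.

(* V : C^U -> C^T is an isometry:  V^* V = 1 *)
Definition isometry (T U : finType) (V : mx T U) : Prop :=
  mxmul (adj V) V = @idmx U.

Definition unitary (T : finType) (U : mx T T) : Prop :=
  mxmul (adj U) U = @idmx T /\ mxmul U (adj U) = @idmx T.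

Definition hermitian (T : finType) (A : mx T T) : Prop :=
  forall x y, A x y = ((A y x)^*)%C.

(* positive semidefinite: hermitian with <v|A|v> >= 0 for every v *)
Definition psd (T : finType) (A : mx T T) : Prop :=
  hermitian A /\
  forall v : vec T, 0 <= \sum_(x : T) \sum_(y : T) ((v x)^*)%C * A x y * v y.

(* density operator (quantum state) *)
Definition density (T : finType) (rho : mx T T) : Prop :=
  psd rho /\ trace rho = 1.

(* supp rho contained in supp mu (for psd operators: ker mu <= ker rho) *)
Definition supp_le (T : finType) (rho mu : mx T T) : Prop :=
  forall v : vec T, apply mu v = (fun=> 0) -> apply rho v = (fun=> 0).

(* U diag(lam) U^*  (columns of U are the eigenvectors) *)
Definition diag_conj (T : finType) (U : mx T T) (lam : T -> R) : mx T T :=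
  fun x y => \sum_(z : T) U x z * (lam z)%:C%C * ((U y z)^*)%C.

(* spectral decomposition of A: A = U diag(lam) U^* with U unitary *)
Definition spectral (T : finType) (A : mx T T) (U : mx T T) (lam : T -> R) :=
  unitary U /\ A = diag_conj U lam.

(* functional calculus: B = f(A) for hermitian A *)
Definition fcalc (T : finType) (f : R -> R) (A B : mx T T) : Prop :=
  exists (U : mx T T) (lam : T -> R), spectral A U lam /\ B = diag_conj U (f \o lam).

(* binary logarithm, taken as 0 at 0 ("logarithm on the support") *)
Definition log2 (x : R) : R := ln x / ln 2.
Definition slog2 (x : R) : R := if x == 0 then 0 else log2 x.

Local Open Scope ereal_scope.

(* von Neumann entropy S(rho) = - tr rho log rho.  The set below consists of
   the values obtained from all spectral decompositions of rho; it is a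
   singleton for a density operator, so its infimum is S(rho). *)
Definition vN_entropy (T : finType) (rho : mx T T) : \bar R :=
  ereal_inf [set e | exists L : mx T T,
    fcalc slog2 rho L /\ e = (- complex.Re (trace (mxmul rho L)))%:E].

(* quantum relative entropy D(rho||mu) = tr rho (log rho - log mu),
   equal to +oo when supp rho is not contained in supp mu. *)
Definition rel_entropy (T : finType) (rho mu : mx T T) : \bar R :=
  ereal_inf [set e |
    (~ supp_le rho mu /\ e = +oo) \/
    (supp_le rho mu /\ exists L1 L2 : mx T T,
       fcalc slog2 rho L1 /\ fcalc slog2 mu L2 /\
       e = (complex.Re (trace (mxmul rho (fun x y => L1 x y - L2 x y))))%:E)].

Local Close Scope ereal_scope.

(* pure state |psi><psi| *)
Definition pure_dm (T : finType) (psi : vec T) : mx T T :=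
  fun x y => psi x * ((psi y)^*)%C.

(* unit vector *)
Definition normalized (T : finType) (psi : vec T) : Prop :=
  \sum_(x : T) psi x * ((psi x)^*)%C = 1.

(* Tripartite systems X (x) Y (x) Z are indexed by (X * Y * Z)%type = ((X*Y)*Z). *)

(* partial traces of an operator on X Y Z *)
Definition ptr_Y (X Y Z : finType) (rho : mx (X * Y * Z)%type (X * Y * Z)%type)
  : mx (X * Z)%type (X * Z)%type :=
  fun u v => \sum_(y : Y) rho (u.1, y, u.2) (v.1, y, v.2).

Definition ptr_YZ (X Y Z : finType) (rho : mx (X * Y * Z)%type (X * Y * Z)%type)
  : mx X X :=
  fun x x' => \sum_(y : Y) \sum_(z : Z) rho (x, y, z) (x', y, z).

(* (VA (x) VB (x) VC) psi *)
Definition embed3 (X Y Z X' Y' Z' : finType)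
  (VX : mx X' X) (VY : mx Y' Y) (VZ : mx Z' Z) (psi : vec (X * Y * Z)%type)
  : vec (X' * Y' * Z')%type :=
  fun w => \sum_(x : X) \sum_(y : Y) \sum_(z : Z)
             VX w.1.1 x * VY w.1.2 y * VZ w.2 z * psi (x, y, z).

(* Quantum Markov state on X Y Z:  H_Y = (+)_j b_j^L (x) b_j^R (orthogonal
   direct sum, realised by isometries W_j : C^(L_j * R_j) -> H_Y with
   mutually orthogonal ranges spanning H_Y), and
   mu = (+)_j p_j  mu^(j)_{X b_j^L} (x) mu^(j)_{b_j^R Z}. *)
Definition markov (X Y Z : finType) (mu : mx (X * Y * Z)%type (X * Y * Z)%type) : Prop :=
  exists (J : nat) (l r : 'I_J -> nat)
         (W : forall j : 'I_J, mx Y ('I_(l j) * 'I_(r j))%type)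
         (p : 'I_J -> R)
         (sigma : forall j : 'I_J, mx (X * 'I_(l j))%type (X * 'I_(l j))%type)
         (tau : forall j : 'I_J, mx ('I_(r j) * Z)%type ('I_(r j) * Z)%type),
    [/\ (forall j, isometry (W j)) /\
        (forall j k : 'I_J, j != k -> mxmul (adj (W j)) (W k) = (fun _ _ => 0)),
        (forall y y' : Y, \sum_(j < J) mxmul (W j) (adj (W j)) y y' = idmx y y'),
        (forall j, 0 <= p j) /\ \sum_(j < J) p j = 1,
        (forall j, density (sigma j) /\ density (tau j)) &
        (forall (x x' : X) (y y' : Y) (z z' : Z),
          mu (x, y, z) (x', y', z') =
          \sum_(j < J) (p j)%:C%C *
            \sum_(a : 'I_(l j)) \sum_(b : 'I_(r j))
            \sum_(a' : 'I_(l j)) \sum_(b' : 'I_(r j))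
              W j y (a, b) * sigma j (x, a) (x', a') * tau j (b, z) (b', z')
              * ((W j y' (a', b'))^*)%C)].

(* Delta(psi) = inf D(psi || mu) over isometric embeddings
   A <= A^ = C^nA, B <= B^ = C^nB, C <= C^ = C^nC and Markov states mu on
   A^ B^ C^. *)
Definition Delta (TA TB TC : finType) (psi : vec (TA * TB * TC)%type) : \bar R :=
  ereal_inf [set e | exists (nA nB nC : nat)
      (VA : mx 'I_nA TA) (VB : mx 'I_nB TB) (VC : mx 'I_nC TC)
      (mu : mx ('I_nA * 'I_nB * 'I_nC)%type ('I_nA * 'I_nB * 'I_nC)%type),
      [/\ isometry VA, isometry VB, isometry VC, density mu /\ markov mu &
          e = rel_entropy (pure_dm (embed3 VA VB VC psi)) mu]].

(* the range of rho_AC lies in the symmetric / antisymmetric subspace of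
   C^d (x) C^d *)
Definition supported_sym (d : nat) (rho : mx ('I_d * 'I_d)%type ('I_d * 'I_d)%type) :=
  forall v : vec ('I_d * 'I_d)%type, forall a c : 'I_d,
    apply rho v (a, c) = apply rho v (c, a).

Definition supported_antisym (d : nat) (rho : mx ('I_d * 'I_d)%type ('I_d * 'I_d)%type) :=
  forall v : vec ('I_d * 'I_d)%type, forall a c : 'I_d,
    apply rho v (a, c) = - apply rho v (c, a).

End Quantum.

(* Main.v *)
(* Lower bound.  After pulling the embeddings back, a Markov state is
   [(+)_j p_j sigma_j (x) tau_j], and [psi] splits into components [psi_j] on
   A L_j R_j C.  Because rho_AC is (anti)symmetric, exchanging A and C only
   changes the sign of [psi] and of every [psi_j].  Write P_j for the reduced
   state of [psi_j] on R_j C, which by the exchange is also that on R_j A, and y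
   for the spectrum of the P_j.  Klein's inequality gives
     - <log (p_j tau_j)> >= - sum y log y,
   and the remaining estimate is
     - <log sigma_j> + <log rho_C> >= sum y log y,
   a form of S(XYZ) <= S(XY) + S(YZ).  The commuting operators sigma_j and
   rho_C^-1 multiply to a positive operator T, and for every t > 0
     <psi|(T + t)^-1|psi> >= 2 Re <psi|chi> - <chi|(T + t)|chi>,
   where chi_j = P_j (1 + t P_j)^-1 psi_j with P_j acting on R_j A.  This says
   that <log (T + t)> - sum y log (1/y + t) is nondecreasing in t; it tends to 0
   at infinity, hence is at most 0 at t = 0.
   Adding the two inequalities yields S(rho_C), which is S(rho_A).

   Upper bound.  rho_A (x) rho_BC is a Markov state at relative entropy
   2 S(rho_A), since rho_A and rho_BC have the same nonzero spectrum. *)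
Require Import Defs.
From mathcomp Require Import all_boot all_order all_algebra.
From mathcomp Require Import all_classical all_reals all_analysis.
From mathcomp Require Import complex.
From mathcomp Require Import ring lra.
Import Order.TTheory GRing.Theory Num.Theory ComplexField.
Import numFieldNormedType.Exports.

Set Implicit Arguments.
Unset Strict Implicit.
Unset Printing Implicit Defensive.

Local Open Scope ring_scope.

(** * From resolvents to logarithms *)

Section LogResolvent.
Variable R : realType.

Lemma is_derive_sum_ln (I : finType) (p x : I -> R) (t : R) :
  (forall i, 0 < x i + t) ->
  is_derive t 1 (fun t => \sum_i p i * ln (x i + t)) (\sum_i p i / (x i + t)).
Proof.
move=> xt0.
have H i : is_derive t (1:R) (fun t => p i * ln (x i + t)) (p i / (x i + t)).
  have h1 : is_derive t (1:R) (fun t : R => x i + t) 1.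
    have h0 := @is_deriveD R R R _ _ _ _ _ _ (is_derive_cst (x i) t (1:R)) (is_derive_id t (1:R)).
    by apply: (is_derive_eq h0); rewrite add0r.
  have h2 := is_derive1_ln (xt0 i).
  have h3 := @is_derive1_comp R (@ln R) (fun t : R => x i + t) t _ _ h2 h1.
  have h4 := @is_deriveZ R R R _ (p i) _ _ _ h3.
  apply: (@is_derive_eq R R R _ _ _ _ _ h4).
  by rewrite ?scale1r ?mulr1 ?mul1r // /GRing.scale /= ?mulr1 ?mul1r.
rewrite (_ : (fun _ => _) = \sum_i (fun t => p i * ln (x i + t))); last first.
  by apply/funext => s; rewrite fct_sumE.
by elim/big_ind2 : _ => // [|] *; [exact: is_derive_cst|exact: is_deriveD].
Qed.

(** The difference F(t) of the two logarithmic sums, with all points shifted by t, has the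
    difference of the resolvent sums as derivative, so it is nondecreasing. Equal total weights give
    it a limit 0 at infinity, whence F(0) <= 0. *)
Lemma ln_ge_sum_resolvent_pos (I K : finType) (p x : I -> R) (q z : K -> R) :
  (forall i, 0 <= p i) -> (forall i, 0 < x i) ->
  (forall k, 0 <= q k) -> (forall k, 0 < z k) ->
  \sum_i p i = \sum_k q k ->
  (forall t : R, 0 < t -> \sum_k q k / (z k + t) <= \sum_i p i / (x i + t)) ->
  \sum_i p i * ln (x i) <= \sum_k q k * ln (z k).
Proof.
move=> p0 x0 q0 z0 pq le_pq.
pose F t := (\sum_i p i * ln (x i + t)) - \sum_k q k * ln (z k + t).
have dF (t : R) : 0 <= t ->
    is_derive t 1 F (\sum_i p i / (x i + t) - \sum_k q k / (z k + t)).
  move=> t0.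
  have h1 := @is_derive_sum_ln I p x t (fun i => ltr_wpDr t0 (x0 i)).
  have h2 := @is_derive_sum_ln K q z t (fun i => ltr_wpDr t0 (z0 i)).
  exact: (@is_deriveB R R R _ _ _ _ _ _ h1 h2).
have F0t (t : R) : 0 < t -> F 0 <= F t.
  move=> t0; apply: (@ger0_derive1_ndecr R F 0 t) => //.
  - move=> s; rewrite in_itv /= => /andP[/ltW s0 _].
    by case: (dF s s0).
  - move=> s; rewrite in_itv /= => /andP[s0 _].
    have [_] := dF s (ltW s0); rewrite derive1E => ->.
    by rewrite subr_ge0 le_pq.
  - apply: derivable_within_continuous => s; rewrite in_itv /= => /andP[s0 _].
    by case: (dF s s0).
  - exact: ltW.
have lnD (a t : R) : 0 < t -> 0 < a -> ln (a + t) = ln t + ln (1 + a / t).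
  move=> t0 a0; rewrite -lnM ?posrE//; last by rewrite ltr_pwDl ?divr_ge0 ?ltW.
  by congr ln; field; rewrite gt_eqF.
(* The terms in [ln t] cancel since the weights have equal sums. Then ln(1 + a/t) >= 0 disposes of
   the [q] terms and ln(1 + a/t) <= a/t bounds the [p] terms. *)
have Ft (t : R) : 0 < t -> F t <= (\sum_i p i * x i) / t.
  move=> t0; rewrite /F.
  under eq_bigr do rewrite lnD// mulrDr.
  rewrite big_split /= -mulr_suml.
  under [X in _ - X]eq_bigr do rewrite lnD// mulrDr.
  rewrite big_split /= -mulr_suml pq opprD addrACA subrr add0r.
  rewrite lerBlDr mulr_suml ler_wpDr//.
    apply: sumr_ge0 => k _; rewrite mulr_ge0// ln_ge0// lerDl divr_ge0 ?ltW//.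
  apply: ler_sum => i _; rewrite -mulrA ler_wpM2l// le_ln1Dx//.
  by rewrite (lt_trans _ (divr_gt0 (x0 i) t0))// ltrN10.
have : F 0 <= 0.
  apply/ler_addgt0Pl => e e0; rewrite addr0.
  set S := \sum_i p i * x i.
  have S0 : 0 <= S by apply: sumr_ge0 => i _; rewrite mulr_ge0// ltW.
  (* At this point S / t is at most e; the added 1 keeps it positive when S = 0. *)
  have t0 : 0 < (S + 1) / e by rewrite divr_gt0// ltr_wpDl.
  apply: (le_trans (F0t _ t0)); apply: (le_trans (Ft _ t0)).
  rewrite -/S invf_div mulrA ler_pdivrMr ?ltr_wpDl// mulrC ler_wpM2l ?(ltW e0)//.
  by rewrite lerDl.
by rewrite subr_le0; under eq_bigr do rewrite addr0; under [X in _ <= X]eq_bigr do rewrite addr0.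
Qed.

(** Eigenvalues 0 occur only with weight 0. Moving the points of weight 0 to 1 changes none of the
    sums and makes every point strictly positive. *)
Lemma ln_ge_sum_resolvent (I K : finType) (p x : I -> R) (q z : K -> R) :
  (forall i, 0 <= p i) -> (forall i, p i != 0 -> 0 < x i) ->
  (forall k, 0 <= q k) -> (forall k, q k != 0 -> 0 < z k) ->
  \sum_i p i = \sum_k q k ->
  (forall t : R, 0 < t -> \sum_k q k / (z k + t) <= \sum_i p i / (x i + t)) ->
  \sum_i p i * ln (x i) <= \sum_k q k * ln (z k).
Proof.
move=> p0 x0 q0 z0 pq le_pq.
pose x' i := if p i == 0 then 1 else x i.
pose z' i := if q i == 0 then 1 else z i.
have px (f : R -> R) i : p i * f (x i) = p i * f (x' i).
  by rewrite /x'; case: eqP => [->|//]; rewrite !mul0r.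
have qz (f : R -> R) i : q i * f (z i) = q i * f (z' i).
  by rewrite /z'; case: eqP => [->|//]; rewrite !mul0r.
rewrite (eq_bigr _ (fun i _ => px (@ln R) i)) (eq_bigr _ (fun i _ => qz (@ln R) i)).
apply: ln_ge_sum_resolvent_pos => //.
- by move=> i; rewrite /x'; case: ifPn => // /x0.
- by move=> i; rewrite /z'; case: ifPn => // /z0.
- move=> t t0; have := le_pq t t0.
  rewrite (eq_bigr _ (fun i _ => qz (fun x => (x + t)^-1) i)).
  by rewrite (eq_bigr _ (fun i _ => px (fun x => (x + t)^-1) i)).
Qed.

End LogResolvent.

(** * Parseval families in C^T *)

Section HilbertSpace.
Variable R : realType.
Local Notation C := R[i].
Local Notation "z ^*" := (conjc z) : ring_scope.

Definition nrm2 (z : C) : R := complex.Re z ^+ 2 + complex.Im z ^+ 2.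

Definition dot (T : finType) (u v : vec R T) : C := \sum_x (u x)^* * v x.

Definition sqn (T : finType) (v : vec R T) : R := \sum_x nrm2 (v x).

(** A Parseval frame: [I] may be larger than the dimension. Unlike orthonormality, this property
    survives the pullback of an eigenbasis along an isometry. *)
Definition resolves_id (I T : finType) (g : I -> vec R T) : Prop :=
  forall x y, \sum_i g i x * (g i y)^* = (x == y)%:R.

Lemma conjcM (z w : C) : (z * w)^* = z^* * w^*.
Proof. exact: rmorphM. Qed.

Lemma conjc_sum (I : Type) (r : seq I) (P : pred I) (F : I -> C) :
  (\sum_(i <- r | P i) F i)^* = \sum_(i <- r | P i) (F i)^*.
Proof. exact: rmorph_sum. Qed.

Lemma nrm2E (z : C) : (nrm2 z)%:C%C = z * z^*.
Proof. by case: z => a b; rewrite /nrm2; apply/eqP; rewrite eq_complex /=; apply/andP; split; apply/eqP; ring. Qed.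

Lemma nrm2_ge0 (z : C) : 0 <= nrm2 z.
Proof. by rewrite addr_ge0 ?sqr_ge0. Qed.

Lemma nrm2_eq0 (z : C) : (nrm2 z == 0) = (z == 0).
Proof.
by rewrite -(inj_eq (@complexI R)) nrm2E mulf_eq0 conjc_eq0 orbb.
Qed.

Lemma nrm2M (z w : C) : nrm2 (z * w) = nrm2 z * nrm2 w.
Proof. by apply: complexI; rewrite rmorphM /= !nrm2E rmorphM /=; ring. Qed.

Lemma nrm2J (z : C) : nrm2 z^* = nrm2 z.
Proof. by apply: complexI; rewrite !nrm2E conjcK mulrC. Qed.

Lemma nrm20 : nrm2 0 = 0.
Proof. by apply/eqP; rewrite nrm2_eq0. Qed.

Lemma nrm2_real (r : R) : nrm2 r%:C%C = r ^+ 2.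
Proof. by rewrite /nrm2 /= expr0n addr0. Qed.

Lemma sqn_ge0 (T : finType) (v : vec R T) : 0 <= sqn v.
Proof. by apply: sumr_ge0 => x _; apply: nrm2_ge0. Qed.

Lemma sqnE (T : finType) (v : vec R T) : (sqn v)%:C%C = dot v v.
Proof.
by rewrite raddf_sum; apply: eq_bigr => x _; rewrite /= nrm2E mulrC.
Qed.

Lemma dotC (T : finType) (u v : vec R T) : (dot u v)^* = dot v u.
Proof.
by rewrite conjc_sum; apply: eq_bigr => x _; rewrite conjcM conjcK mulrC.
Qed.

Lemma sqn_sub (T : finType) (u v : vec R T) :
  sqn (fun x => u x - v x) = sqn u + sqn v - 2 * complex.Re (dot u v).
Proof.
rewrite /sqn /dot raddf_sum /= mulr_sumr -big_split /= -sumrB.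
by apply: eq_bigr => x _; case: (u x) (v x) => a b [c d]; rewrite /nrm2 /=; ring.
Qed.

(** Cauchy-Schwarz: the squared norm of |v|^2 u - <v|u> v equals |v|^2 times the difference of the
    two sides. *)
Lemma nrm2_dot_le (T : finType) (u v : vec R T) :
  nrm2 (dot u v) <= sqn u * sqn v.
Proof.
have [v0|vN0] := eqVneq (sqn v) 0.
  have v_eq0 x : v x = 0.
    apply/eqP; rewrite -nrm2_eq0; apply/eqP.
    by apply: (psumr_eq0P _ v0) => // y _; apply: nrm2_ge0.
  by rewrite v0 mulr0 /dot big1 ?nrm20// => x _; rewrite v_eq0 mulr0.
have v_gt0 : 0 < sqn v by rewrite lt_def vN0 sqn_ge0.
rewrite -subr_ge0 -(pmulr_rge0 _ v_gt0).
have := sqn_ge0 (fun x => (sqn v)%:C%C * u x - dot v u * v x).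
rewrite sqn_sub.
have -> : sqn (fun x => (sqn v)%:C%C * u x) = sqn v ^+ 2 * sqn u.
  by rewrite mulr_sumr; apply: eq_bigr => x _; rewrite nrm2M nrm2_real.
have -> : sqn (fun x => dot v u * v x) = nrm2 (dot u v) * sqn v.
  by rewrite mulr_sumr; apply: eq_bigr => x _; rewrite nrm2M -dotC nrm2J.
have -> : dot (fun x => (sqn v)%:C%C * u x) (fun x => dot v u * v x) =
    (sqn v * nrm2 (dot u v))%:C%C.
  rewrite rmorphM /= nrm2E dotC.
  transitivity ((sqn v)%:C%C * dot v u * dot u v); last by ring.
  rewrite [dot u v]/dot mulr_sumr [LHS]/dot; apply: eq_bigr => x _.
  by rewrite conjcM conjc_real; ring.
by move=> h; apply: le_trans h _; rewrite le_eqVlt; apply/orP; left; apply/eqP=> /=; ring.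
Qed.

Lemma resolves_id_expand (I T : finType) (g : I -> vec R T) (v : vec R T) x :
  resolves_id g -> v x = \sum_i g i x * dot (g i) v.
Proof.
move=> gid; rewrite /dot.
under eq_bigr => i _ do rewrite mulr_sumr.
rewrite exchange_big /= (bigD1 x)//= [X in _ + X]big1 ?addr0.
  under eq_bigr => i _ do rewrite mulrA.
  by rewrite -mulr_suml gid eqxx mul1r.
move=> y /negbTE yx; under eq_bigr => i _ do rewrite mulrA.
by rewrite -mulr_suml gid eq_sym yx mul0r.
Qed.

Lemma parseval_dot (I T : finType) (g : I -> vec R T) (u v : vec R T) :
  resolves_id g -> \sum_i (dot (g i) u)^* * dot (g i) v = dot u v.
Proof.
move=> gid; rewrite [RHS]/dot.
under [RHS]eq_bigr => x _ do rewrite (resolves_id_expand v x gid) mulr_sumr.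
rewrite exchange_big; apply: eq_bigr => i _.
by rewrite dotC /dot mulr_suml; apply: eq_bigr => x _; rewrite mulrA.
Qed.

Lemma parseval (I T : finType) (g : I -> vec R T) (v : vec R T) :
  resolves_id g -> \sum_i nrm2 (dot (g i) v) = sqn v.
Proof.
move=> gid; apply: complexI; rewrite (sqnE v) -(parseval_dot v v gid) raddf_sum.
by apply: eq_bigr => i _; rewrite /= nrm2E mulrC.
Qed.

(** In Parseval's identity for [g i], the i-th term alone is the square of [sqn (g i)], so that
    square is at most [sqn (g i)]. *)
Lemma resolves_id_sqn_le1 (I T : finType) (g : I -> vec R T) i :
  resolves_id g -> sqn (g i) <= 1.
Proof.
move=> gid; have := parseval (g i) gid.
rewrite (bigD1 i)//= -sqnE nrm2_real => h.
have : sqn (g i) ^+ 2 <= sqn (g i).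
  by rewrite -[X in _ <= X]h lerDl sumr_ge0// => j _; apply: nrm2_ge0.
have := sqn_ge0 (g i); nra.
Qed.

Lemma resolves_id_weight_le1 (I T : finType) (g : I -> vec R T) (v : vec R T) :
  resolves_id g -> sqn v <= 1 -> \sum_i nrm2 (dot v (g i)) <= 1.
Proof.
by move=> gid; rewrite -(parseval v gid); under eq_bigr do rewrite -dotC nrm2J.
Qed.

Definition orthonormal_fam (I T : finType) (g : I -> vec R T) : Prop :=
  forall i j, dot (g i) (g j) = (i == j)%:R.

Lemma orthonormal_sqn (I T : finType) (g : I -> vec R T) i :
  orthonormal_fam g -> sqn (g i) = 1.
Proof. by move=> gon; apply: complexI; rewrite sqnE gon eqxx. Qed.

Lemma sqn_lincomb (I T : finType) (g : I -> vec R T) (c : I -> C) :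
  orthonormal_fam g -> sqn (fun x => \sum_i c i * g i x) = \sum_i nrm2 (c i).
Proof.
move=> gon; apply: complexI; rewrite sqnE raddf_sum /dot /=.
under eq_bigr => x _ do rewrite mulr_sumr.
rewrite exchange_big; apply: eq_bigr => i _ /=.
rewrite nrm2E mulrC.
transitivity (c i * \sum_j (c j)^* * dot (g j) (g i)).
  rewrite mulr_sumr /dot.
  under [RHS]eq_bigr => j _ do rewrite mulrA mulr_sumr.
  rewrite exchange_big; apply: eq_bigr => x _ /=.
  rewrite conjc_sum mulr_suml; apply: eq_bigr => j _.
  by rewrite conjcM; ring.
rewrite (bigD1 i)//= big1 ?addr0; last first.
  by move=> j /negbTE ji; rewrite gon ji mulr0.
by rewrite gon eqxx mulr1 mulrC.
Qed.

(* Duality: the synthesis bound says that [c |-> \sum_i c i * e i] is a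
   contraction for the weight lam, and its adjoint is then one too. *)
Lemma bessel (I T : finType) (e : I -> vec R T) (lam : I -> R) (v : vec R T) :
  (forall i, 0 <= lam i) ->
  (forall c : I -> C, sqn (fun x => \sum_i c i * e i x) <=
                      \sum_i lam i * nrm2 (c i)) ->
  \sum_i nrm2 (dot v (e i)) / lam i <= sqn v.
Proof.
move=> lam0 He.
(* With these coefficients both <v|sum c e> and the bound sum lam |c|^2 equal the sum to be
   estimated, so |v - sum c e|^2 >= 0 gives the claim. An index with [lam i = 0] contributes 0, as
   [0^-1 = 0]. *)
pose c i := (dot v (e i))^* * ((lam i)^-1)%:C%C.
have hd : dot v (fun x => \sum_i c i * e i x) = (\sum_i nrm2 (dot v (e i)) / lam i)%:C%C.
  rewrite /dot raddf_sum /=.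
  under eq_bigr => x _ do rewrite mulr_sumr.
  rewrite exchange_big; apply: eq_bigr => i _ /=.
  transitivity (c i * dot v (e i)).
    by rewrite [dot v (e i)]/dot mulr_sumr; apply: eq_bigr => x _; ring.
  by rewrite rmorphM /= nrm2E /c mulrAC; congr (_ * _); apply: mulrC.
have hc : \sum_i lam i * nrm2 (c i) = \sum_i nrm2 (dot v (e i)) / lam i.
  apply: eq_bigr => i _; rewrite /c nrm2M nrm2J nrm2_real.
  have [->|l0] := eqVneq (lam i) 0; first by rewrite invr0 expr0n !mulr0.
  by field.
have := sqn_ge0 (fun x => v x - \sum_i c i * e i x).
rewrite sqn_sub hd /=; have := He c; rewrite hc; lra.
Qed.

End HilbertSpace.

(** * One block of a Markov state *)

Section Block.
Variable R : realType.
Local Notation C := R[i].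
Local Notation "z ^*" := (conjc z) : ring_scope.

Lemma dot_exchange (S T : finType) (u : vec R S) (v : vec R T) (F : S -> T -> C) :
  dot u (fun x => dot v (F x)) = dot v (fun y => dot u (F^~ y)).
Proof.
rewrite /dot; under eq_bigr => x _ do rewrite mulr_sumr.
rewrite exchange_big; apply: eq_bigr => y _.
by rewrite mulr_sumr; apply: eq_bigr => x _; rewrite mulrCA.
Qed.

Lemma sum_pair (V : nmodType) (S T : finType) (F : S * T -> V) :
  \sum_p F p = \sum_a \sum_b F (a, b).
Proof. by rewrite pair_bigA; apply: eq_bigr => -[]. Qed.

(** Passes from the cut (a, l) | (r, c), in which sigma_j and tau_j act, to the cut (r, a) | (l, c),
    in which P_j acts after the exchange. *)
Lemma sum_exchange_factors (V : nmodType) (A L M E : finType)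
    (F : A * L -> M * E -> V) :
  \sum_x \sum_w F x w =
  \sum_(z : (M * A)%type) \sum_(y : (L * E)%type) F (z.2, y.1) (z.1, y.2).
Proof.
rewrite !pair_bigA /=.
rewrite (reindex (fun p : (M * A) * (L * E) => ((p.1.2, p.2.1), (p.1.1, p.2.2)))) //=.
by exists (fun p : (A * L) * (M * E) => ((p.2.1, p.1.1), (p.1.2, p.2.2))) => -[[a b] [c d]].
Qed.

(** Completing the square: x times the difference of the sides is |a - x b|^2. This is the
    variational bound for the resolvent in a single coordinate. *)
Lemma Re_mul_le (x : R) (a b : C) : 0 < x ->
  2 * complex.Re (a^* * b) - x * nrm2 b <= nrm2 a / x.
Proof.
move=> x0; rewrite ler_pdivlMr// -subr_ge0.
have -> : nrm2 a - (2 * complex.Re (a^* * b) - x * nrm2 b) * x =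
    nrm2 (a - x%:C%C * b).
  by case: a b => a1 a2 [b1 b2]; rewrite /nrm2 /=; ring.
exact: nrm2_ge0.
Qed.

Section Amplitudes.
Variables (A L M E I : finType) (u : I -> vec R (A * L)%type) (h : E -> vec R A).

(** In the coordinates (i, r, e) the operator T, built from sigma_j and the inverse of rho_C,
    becomes multiplication by [s i / lam e]; the index r of M is a spectator. *)
Definition amp (Phi : A * L -> M * A -> C) (i : I) (r : M) (e : E) : C :=
  dot (h e) (fun c => dot (u i) (fun x => Phi x (r, c))).

Lemma amp_dot (Phi Phi' : A * L -> M * A -> C) :
  resolves_id u -> resolves_id h ->
  \sum_i \sum_r \sum_e (amp Phi i r e)^* * amp Phi' i r e =
  \sum_x \sum_w (Phi x w)^* * Phi' x w.
Proof.
move=> uid hid.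
under eq_bigr => i _ do under eq_bigr => r _ do rewrite parseval_dot// /dot.
under eq_bigr => i _ do rewrite pair_bigA /=.
rewrite exchange_big [RHS]exchange_big /=; apply: eq_bigr => -[r c] _.
exact: (@parseval_dot R I _ u (fun x => Phi x (r, c)) (fun x => Phi' x (r, c))).
Qed.

Lemma amp_sqn (Phi : A * L -> M * A -> C) :
  resolves_id u -> resolves_id h ->
  \sum_i \sum_r \sum_e nrm2 (amp Phi i r e) = \sum_x \sum_w nrm2 (Phi x w).
Proof.
move=> uid hid; apply: complexI.
transitivity (\sum_i \sum_r \sum_e (amp Phi i r e)^* * amp Phi i r e).
  do 3 (rewrite raddf_sum; apply: eq_bigr => ? _).
  by rewrite /= nrm2E mulrC.
rewrite amp_dot// raddf_sum; apply: eq_bigr => x _.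
by rewrite raddf_sum; apply: eq_bigr => w _; rewrite /= nrm2E mulrC.
Qed.

End Amplitudes.

Section OneBlock.
Variables (A L M : finType) (Psi : A * L -> M * A -> C).
Variables (f : M * A -> vec R (M * A)%type) (y : M * A -> R).
Hypotheses (f_on : orthonormal_fam f) (f_id : resolves_id f).

(* [Psi] has the indices (a, l), (r, c); [f] will diagonalise its reduced state
   on the pair (r, a). *)
Definition schmidt_vec (m : M * A) : vec R (L * A)%type :=
  fun q => dot (f m) (fun z => Psi (z.2, q.1) (z.1, q.2)).

Hypothesis y_def : forall m, sqn (schmidt_vec m) = y m.

Lemma schmidt_weight_ge0 m : 0 <= y m.
Proof. by rewrite -y_def sqn_ge0. Qed.

Variable al : M * A -> R.

(** The vector al(P) Psi, where P acts on the pair (r, a): [schmidt_vec m] is the component of [Psi]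
    along [f m]. For a suitable [al] this is the chi_j of the overview. *)
Definition damped : A * L -> M * A -> C := fun x w =>
  \sum_m (al m)%:C%C * schmidt_vec m (x.2, w.2) * f m (w.1, x.1).

Lemma damped_dot :
  \sum_x \sum_w (Psi x w)^* * damped x w = (\sum_m al m * y m)%:C%C.
Proof.
rewrite sum_exchange_factors exchange_big /=.
transitivity (\sum_(q : (L * A)%type) \sum_m (al m)%:C%C * (nrm2 (schmidt_vec m q))%:C%C).
  apply: eq_bigr => q _; rewrite /damped /=.
  under eq_bigr => z _ do rewrite mulr_sumr.
  rewrite exchange_big /=; apply: eq_bigr => m _.
  rewrite nrm2E mulrA.
  have -> : (schmidt_vec m q)^* = dot (fun z => Psi (z.2, q.1) (z.1, q.2)) (f m).
    by rewrite /schmidt_vec dotC.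
  rewrite /dot mulr_sumr.
  by apply: eq_bigr => -[r a] _ /=; ring.
rewrite exchange_big raddf_sum; apply: eq_bigr => m _.
by rewrite /= -mulr_sumr -y_def rmorphM /= raddf_sum.
Qed.

Lemma damped_sqn :
  \sum_x \sum_w nrm2 (damped x w) = \sum_m al m ^+ 2 * y m.
Proof.
rewrite sum_exchange_factors exchange_big /=.
transitivity (\sum_(q : (L * A)%type) \sum_m al m ^+ 2 * nrm2 (schmidt_vec m q)).
  apply: eq_bigr => q _.
  transitivity (sqn (fun z => \sum_m ((al m)%:C%C * schmidt_vec m q) * f m z)).
    by apply: eq_bigr => -[r a] _; rewrite /damped /= -surjective_pairing.
  by rewrite sqn_lincomb//; apply: eq_bigr => m _; rewrite nrm2M nrm2_real.
by rewrite exchange_big; apply: eq_bigr => m _; rewrite -mulr_sumr -y_def.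
Qed.

Variables (E I : finType) (u : I -> vec R (A * L)%type) (h : E -> vec R A).
Variables (s : I -> R) (lam : E -> R).
Hypotheses (u_id : resolves_id u) (h_id : resolves_id h).
Hypotheses (s_ge0 : forall i, 0 <= s i) (s_le1 : \sum_i s i <= 1).
Hypothesis lam_ge0 : forall e, 0 <= lam e.

(** The unnormalised state left on L, M and A once C is found in [h e]. The hypothesis below bounds
    the Gram matrix of these vectors by diag(lam), as [bessel] requires. *)
Definition cond_vec (e : E) : vec R (L * (M * A))%type :=
  fun q => dot (h e) (fun c => Psi (q.2.2, q.1) (q.2.1, c)).

Hypothesis cond_contr : forall c : E -> C,
  sqn (fun q => \sum_e c e * cond_vec e q) <= \sum_e lam e * nrm2 (c e).

(** This is al(P) applied to |r> (x) [u i]: the self-adjoint al(P) is moved from [Psi] to the other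
    side of the amplitude. *)
Definition test_vec (i : I) (r : M) : vec R (L * (M * A))%type := fun q =>
  \sum_m ((al m)%:C%C * dot (fun a => f m (r, a)) (fun a => u i (a, q.1))) * f m q.2.

Lemma amp_damped i r e : amp u h damped i r e = dot (test_vec i r) (cond_vec e).
Proof.
rewrite -dot_exchange; congr dot; apply/funext => c.
rewrite /dot /damped /test_vec /=.
under [RHS]eq_bigr => q _ do rewrite conjc_sum mulr_suml.
under [LHS]eq_bigr => x _ do rewrite mulr_sumr.
rewrite exchange_big [RHS]exchange_big; apply: eq_bigr => m _ /=.
rewrite sum_pair exchange_big sum_pair /=.
apply: eq_bigr => l _.
transitivity (((al m)%:C%C * \sum_a (f m (r, a))^* * u i (a, l))^* * schmidt_vec m (l, c)).
  rewrite conjcM conjc_real conjc_sum [RHS]mulrAC [RHS]mulr_sumr; apply: eq_bigr => a _.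
  by rewrite conjcM conjcK; ring.
rewrite /schmidt_vec /dot [LHS]mulr_sumr; apply: eq_bigr => z _.
by rewrite [in RHS]conjcM mulrA.
Qed.

(** The right side is Tr al(P)^2. Cauchy-Schwarz on the A slices bounds each coefficient; the slices
    of [f m] have total square norm 1 over r, and those of [u i] at most 1 over l. *)
Lemma test_vec_sqn i : \sum_r sqn (test_vec i r) <= \sum_m al m ^+ 2.
Proof.
have hr r : sqn (test_vec i r) <=
    \sum_m al m ^+ 2 * (sqn (fun a => f m (r, a)) * sqn (u i)).
  rewrite [X in X <= _](_ : _ = \sum_l sqn (fun z => test_vec i r (l, z))); last first.
    by rewrite /sqn pair_bigA; apply: eq_bigr => -[].
  rewrite /test_vec /=; under eq_bigr => l _ do rewrite sqn_lincomb//.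
  rewrite exchange_big; apply: ler_sum => m _ /=.
  under eq_bigr => l _ do rewrite nrm2M nrm2_real.
  rewrite -mulr_sumr ler_wpM2l ?sqr_ge0//.
  have -> : sqn (u i) = \sum_l sqn (fun a => u i (a, l)).
    by rewrite /sqn exchange_big pair_bigA; apply: eq_bigr => -[].
  by rewrite mulr_sumr; apply: ler_sum => l _; apply: nrm2_dot_le.
apply: (le_trans (ler_sum _ (fun r _ => hr r))).
rewrite exchange_big; apply: ler_sum => m _ /=.
rewrite -mulr_sumr -mulr_suml ler_piMr ?sqr_ge0//.
have -> : \sum_r sqn (fun a => f m (r, a)) = sqn (f m).
  by rewrite /sqn pair_bigA; apply: eq_bigr => -[].
by rewrite orthonormal_sqn// mul1r resolves_id_sqn_le1.
Qed.

(** This bounds <chi|T|chi> by Tr al(P)^2. For fixed (i, r), [bessel] absorbs the singular weights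
    [1 / lam e]; the sum over r is [test_vec_sqn], and the weights [s i] sum to at most 1. *)
Lemma damped_weight :
  \sum_i \sum_r \sum_e s i / lam e * nrm2 (amp u h damped i r e) <=
  \sum_m al m ^+ 2.
Proof.
have hi i : \sum_r \sum_e s i / lam e * nrm2 (amp u h damped i r e) <=
    s i * \sum_m al m ^+ 2.
  apply: le_trans (ler_wpM2l (s_ge0 i) (test_vec_sqn i)).
  rewrite mulr_sumr; apply: ler_sum => r _.
  apply: le_trans (ler_wpM2l (s_ge0 i) (bessel (test_vec i r) lam_ge0 cond_contr)).
  rewrite mulr_sumr; apply: ler_sum => e _.
  by rewrite amp_damped -mulrA [_^-1 * _]mulrC.
apply: (le_trans (ler_sum _ (fun i _ => hi i))).
by rewrite -mulr_suml ler_piMl// sumr_ge0// => m _; apply: sqr_ge0.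
Qed.

End OneBlock.
End Block.

(** * Resolvent bound and Klein inequality for one block *)

Section BlockBounds.
Variable R : realType.
Local Notation C := R[i].
Local Notation "z ^*" := (conjc z) : ring_scope.

(** The variational bound for <psi|(T + t)^-1|psi> with trial vector [damped]: its three ingredients
    are [damped_dot], [damped_sqn] and [damped_weight]. *)
Lemma block_resolvent (A L M E I : finType) (Psi : A * L -> M * A -> C)
    (f : M * A -> vec R (M * A)%type) (y : M * A -> R)
    (u : I -> vec R (A * L)%type) (h : E -> vec R A) (s : I -> R) (lam : E -> R)
    (t : R) :
  orthonormal_fam f -> (forall m, sqn (schmidt_vec Psi f m) = y m) ->
  resolves_id u -> resolves_id h ->
  (forall i, 0 <= s i) -> \sum_i s i <= 1 -> (forall e, 0 <= lam e) ->
  (forall c : E -> C, sqn (fun q => \sum_e c e * cond_vec Psi h e q) <=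
                      \sum_e lam e * nrm2 (c e)) ->
  0 < t ->
  \sum_m y m / ((y m)^-1 + t) <=
  \sum_i \sum_r \sum_e nrm2 (amp u h Psi i r e) / (s i / lam e + t).
Proof.
move=> f_on y_def u_id h_id s0 s1 lam0 contr t0.
have y0 := schmidt_weight_ge0 y_def.
(* For each m this maximises 2 al y - al^2 (1 + t y), and the maximum is y / (1/y + t), so the last
   comparison is an equality. At y = 0 both sides are 0. *)
pose al m := y m / (1 + t * y m).
pose b i r e := amp u h (damped Psi f al) i r e.
have xt0 i e : 0 < s i / lam e + t by rewrite ltr_wpDl// divr_ge0.
pose a i r e := amp u h Psi i r e.
apply: (@le_trans _ _ (\sum_i \sum_r \sum_e
    (2 * complex.Re ((a i r e)^* * b i r e) - (s i / lam e + t) * nrm2 (b i r e)))); last first.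
  do 3 (apply: ler_sum => ? _); exact: Re_mul_le.
have -> : \sum_i \sum_r \sum_e
    (2 * complex.Re ((a i r e)^* * b i r e) - (s i / lam e + t) * nrm2 (b i r e)) =
   2 * complex.Re (\sum_i \sum_r \sum_e (a i r e)^* * b i r e) -
   (\sum_i \sum_r \sum_e s i / lam e * nrm2 (b i r e) +
    t * \sum_i \sum_r \sum_e nrm2 (b i r e)).
  do 3 (rewrite !raddf_sum /= !mulr_sumr -big_split /= -sumrB; apply: eq_bigr => ? _).
  by ring.
rewrite /a /b amp_dot// (damped_dot y_def) amp_sqn// (damped_sqn f_on y_def) /=.
have := damped_weight f_on al u_id s0 s1 lam0 contr.
set W := (X in X <= _) => leW.
apply: (@le_trans _ _ (2 * (\sum_m al m * y m) -
   (\sum_m al m ^+ 2 + t * \sum_m al m ^+ 2 * y m))); last first.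
  by rewrite lerD2l lerN2 lerD2r.
rewrite !mulr_sumr -big_split /= -sumrB; apply: ler_sum => m _.
rewrite le_eqVlt; apply/orP; left; apply/eqP; rewrite /al.
have [->|yN0] := eqVneq (y m) 0; first by rewrite !(mul0r, mulr0, expr0n)/= addr0 oppr0 addr0.
have ty : 1 + t * y m != 0 by rewrite gt_eqF// ltr_pwDl// mulr_ge0// ltW.
by field; rewrite yN0 ty.
Qed.

(** This is ln(nu / y) <= nu / y - 1 multiplied by y d. The degenerate cases rest on [ln 0 = 0] and,
    for nu = 0, on the support condition. *)
Lemma gibbs_term (y d nu : R) : 0 <= y -> 0 <= d -> 0 <= nu ->
  (nu = 0 -> y * d = 0) ->
  y * d * ln nu <= d * (y * ln y) + (nu - y) * d.
Proof.
move=> y0 d0 nu0 nud.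
have [y_eq0|yN0] := eqVneq y 0.
  by rewrite y_eq0 !mul0r mulr0 add0r subr0 mulr_ge0.
have [nu_eq0|nuN0] := eqVneq nu 0.
  have /eqP := nud nu_eq0; rewrite mulf_eq0 (negbTE yN0) /= => /eqP ->.
  by rewrite !(mul0r, mulr0) addr0.
have yp : 0 < y by rewrite lt_def yN0.
have nup : 0 < nu by rewrite lt_def nuN0.
have : ln nu - ln y <= nu / y - 1.
  rewrite -ln_div ?posrE// -[X in ln X](subrKC 1) le_ln1Dx//.
  by rewrite ltrBrDl subrr divr_gt0.
move=> /(ler_wpM2l (mulr_ge0 y0 d0)).
have -> : y * d * (nu / y - 1) = (nu - y) * d by field.
by lra.
Qed.

(** The hypothesis is a spectral form of the reduced operator of [Psi] on S; both sides are its
    matrix element between [v] and [v']. *)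
Lemma reduced_form (X S N : finType) (Psi : X -> S -> C) (f : N -> vec R S)
    (y : N -> R) (v v' : vec R S) :
  (forall w w', \sum_x Psi x w * (Psi x w')^* = \sum_m (y m)%:C%C * f m w * (f m w')^*) ->
  \sum_x dot v (Psi x) * (dot v' (Psi x))^* =
  \sum_m (y m)%:C%C * dot v (f m) * (dot v' (f m))^*.
Proof.
move=> spec.
transitivity (\sum_w \sum_w' (v w)^* * v' w' * \sum_x Psi x w * (Psi x w')^*).
  symmetry; transitivity (\sum_x \sum_w \sum_w' (v w)^* * v' w' * (Psi x w * (Psi x w')^*)).
    rewrite [RHS]exchange_big; apply: eq_bigr => w _ /=; rewrite [RHS]exchange_big.
    by apply: eq_bigr => w' _; rewrite mulr_sumr.
  apply: eq_bigr => x _; symmetry.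
  rewrite dotC /dot mulr_suml; apply: eq_bigr => w _ /=.
  by rewrite mulr_sumr; apply: eq_bigr => w' _; ring.
transitivity (\sum_m \sum_w \sum_w' (v w)^* * v' w' * ((y m)%:C%C * f m w * (f m w')^*)).
  rewrite [RHS]exchange_big; apply: eq_bigr => w _ /=; rewrite [RHS]exchange_big.
  by apply: eq_bigr => w' _; rewrite spec mulr_sumr.
apply: eq_bigr => m _.
rewrite dotC -mulrA /dot mulr_suml mulr_sumr; apply: eq_bigr => w _.
by rewrite !mulr_sumr; apply: eq_bigr => w' _; ring.
Qed.

Lemma reduced_weight (X S N : finType) (Psi : X -> S -> C) (f : N -> vec R S)
    (y : N -> R) (v : vec R S) :
  (forall w w', \sum_x Psi x w * (Psi x w')^* = \sum_m (y m)%:C%C * f m w * (f m w')^*) ->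
  \sum_x nrm2 (dot v (Psi x)) = \sum_m y m * nrm2 (dot v (f m)).
Proof.
move=> spec; apply: complexI; rewrite !raddf_sum /=.
under eq_bigr do rewrite nrm2E.
rewrite (reduced_form _ _ spec).
by apply: eq_bigr => m _; rewrite rmorphM /= nrm2E mulrA.
Qed.

(** The overlaps |<v k|f m>|^2 sum to 1 over k and to at most 1 over m. Weighting [gibbs_term] by
    them gives Klein's inequality, with the trace correction kept because neither operator is
    normalised inside a block. *)
Lemma block_klein (X S K : finType) (Psi : X -> S -> C) (f : S -> vec R S)
    (y : S -> R) (v : K -> vec R S) (nu : K -> R) :
  orthonormal_fam f -> resolves_id f -> (forall m, 0 <= y m) ->
  (forall w w', \sum_x Psi x w * (Psi x w')^* = \sum_m (y m)%:C%C * f m w * (f m w')^*) ->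
  resolves_id v -> (forall k, 0 <= nu k) ->
  (forall k, nu k = 0 -> \sum_x nrm2 (dot (v k) (Psi x)) = 0) ->
  \sum_k (\sum_x nrm2 (dot (v k) (Psi x))) * ln (nu k) <=
  \sum_m y m * ln (y m) + \sum_k nu k - \sum_m y m.
Proof.
move=> f_on f_id y0 spec v_id nu0 supp.
pose d k m := nrm2 (dot (v k) (f m)).
have wE k : \sum_x nrm2 (dot (v k) (Psi x)) = \sum_m y m * d k m.
  exact: reduced_weight.
have d0 k m : 0 <= d k m by apply: nrm2_ge0.
have yd0 k m : 0 <= y m * d k m by rewrite mulr_ge0.
apply: (@le_trans _ _ (\sum_k \sum_m (d k m * (y m * ln (y m)) + (nu k - y m) * d k m))).
  apply: ler_sum => k _; rewrite wE mulr_suml; apply: ler_sum => m _.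
  apply: gibbs_term => // nuk.
  have := supp k nuk; rewrite wE => h.
  exact: (psumr_eq0P _ h).
have sd m : \sum_k d k m = 1.
  by rewrite /d parseval// orthonormal_sqn.
have -> : \sum_k \sum_m (d k m * (y m * ln (y m)) + (nu k - y m) * d k m) =
    \sum_m y m * ln (y m) + \sum_k nu k * (\sum_m d k m) - \sum_m y m.
  under eq_bigr => k _ do rewrite big_split /=.
  rewrite big_split /= -addrA; congr (_ + _).
    by rewrite exchange_big; apply: eq_bigr => m _; rewrite -mulr_suml sd mul1r.
  have -> : \sum_m y m = \sum_m \sum_k y m * d k m.
    by apply: eq_bigr => m _; rewrite -mulr_sumr sd mulr1.
  rewrite [in RHS]exchange_big -sumrB; apply: eq_bigr => k _.
  by rewrite mulr_sumr -sumrB; apply: eq_bigr => m _; ring.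
rewrite lerD2r lerD2l; apply: ler_sum => k _; rewrite ler_piMr//.
by rewrite resolves_id_weight_le1// resolves_id_sqn_le1.
Qed.

End BlockBounds.

(** * Spectral decompositions *)

(** The matrix spectral theorem unfolded into entries, ready for transport to an arbitrary finite
    index type. The eigenvectors are the conjugated rows of [S]. *)
Lemma hermitian_mx_diag (F : numClosedFieldType) n (A : 'M[F]_n) :
  (forall i j, A i j = Num.conj (A j i)) ->
  exists (S : 'M[F]_n) (D : 'I_n -> F),
    [/\ forall i j, \sum_k S i k * Num.conj (S j k) = (i == j)%:R,
        forall i j, \sum_k Num.conj (S k i) * S k j = (i == j)%:R,
        forall k, D k \is Num.real &
        forall i j, A i j = \sum_k Num.conj (S k i) * D k * S k j].
Proof.
move=> hA0.
have /mxOverP D_real : spectral_diag A \is a mxOver Num.real.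
  apply: hermitian_spectral_diag_real; apply/is_hermitianmxP/matrixP => i j.
  by rewrite expr0 scale1r !mxE hA0.
have /orthomx_spectralP : A \is normalmx.
  apply: hermitian_normalmx; apply/is_hermitianmxP/matrixP => i j.
  by rewrite expr0 scale1r !mxE hA0.
have uS := spectral_unitarymx A.
have StS := mulVmx (spectral_unit A).
move: StS; rewrite (invmx_unitary uS) => /matrixP StS.
have /unitarymxP/matrixP SSt := uS.
move=> /matrixP AE.
exists (spectralmx A), (spectral_diag A 0); split=> // i j.
- by have := SSt i j; rewrite !mxE => <-; apply: eq_bigr => k _; rewrite !mxE.
- by have := StS i j; rewrite !mxE => <-; apply: eq_bigr => k _; rewrite !mxE.
- rewrite AE mxE; apply: eq_bigr => k _; congr (_ * _).
  by rewrite mul_mx_diag !mxE.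
Qed.

Section Spectral.
Variable R : realType.
Local Notation C := R[i].
Local Notation "z ^*" := (conjc z) : ring_scope.

Lemma hermitian_spectral (T : finType) (P : mx R T T) :
  Defs.hermitian P -> exists U lam, spectral P U lam.
Proof.
move=> hP.
pose A : 'M[C]_#|T| := \matrix_(i, j) P (enum_val i) (enum_val j).
have [|S [D [SSt StS D_real AE]]] := @hermitian_mx_diag _ _ A.
  by move=> i j; rewrite !mxE hP.
exists (fun x z => (S (enum_rank z) (enum_rank x))^*), (fun z => complex.Re (D (enum_rank z))).
have sumT (F : 'I_#|T| -> C) : \sum_(z : T) F (enum_rank z) = \sum_k F k.
  by rewrite [RHS](reindex (@enum_rank T))//=; exists enum_val => k _; rewrite ?enum_rankK ?enum_valK.
split; first split.
- apply/funext => x; apply/funext => y; rewrite /mxmul /adj /idmx.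
  rewrite (sumT (fun k => (S (enum_rank x) k)^*^* * (S (enum_rank y) k)^*)).
  rewrite -(inj_eq enum_rank_inj) -SSt.
  by apply: eq_bigr => k _; rewrite conjcK.
- apply/funext => x; apply/funext => y; rewrite /mxmul /adj /idmx.
  rewrite (sumT (fun k => (S k (enum_rank x))^* * (S k (enum_rank y))^*^*)).
  rewrite -(inj_eq enum_rank_inj) -StS.
  by apply: eq_bigr => k _; rewrite conjcK.
- apply/funext => x; apply/funext => y; rewrite /diag_conj.
  have := AE (enum_rank x) (enum_rank y).
  rewrite mxE !enum_rankK => ->.
  rewrite (sumT (fun k => (S k (enum_rank x))^* * (complex.Re (D k))%:C%C * (S k (enum_rank y))^*^*)).
  apply: eq_bigr => k _; rewrite conjcK; congr (_ * _ * _).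
  by have /complex_realP [r ->] := D_real k.
Qed.

End Spectral.

(** * The entropy inequality *)

Section Core.
Variable R : realType.
Local Notation C := R[i].
Local Notation "z ^*" := (conjc z) : ring_scope.

Lemma unitary_columns (T : finType) (U : mx R T T) : unitary U ->
  orthonormal_fam (fun z x => U x z) /\ resolves_id (fun z x => U x z).
Proof.
move=> [U1 U2]; split=> x y.
  exact: (congr1 (fun F => F x y) U1).
exact: (congr1 (fun F => F x y) U2).
Qed.

(** The exchange symmetry enters here. Diagonalising the reduced state on (r, c) gives [f] and [y];
    swapping a and c only multiplies [Psi] by a phase, so the same [f] and [y] describe the reduced
    state on (r, a), which is what [schmidt_vec] sees. *)
Lemma block_spectrum (A L M : finType) (Psi : A * L -> M * A -> C) (sg : C) :
  sg * sg^* = 1 ->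
  (forall a l r c, Psi (c, l) (r, a) = sg * Psi (a, l) (r, c)) ->
  exists (f : M * A -> vec R (M * A)%type) (y : M * A -> R),
    [/\ orthonormal_fam f, resolves_id f,
        forall m, sqn (schmidt_vec Psi f m) = y m &
        forall w w', \sum_x Psi x w * (Psi x w')^* =
                     \sum_m (y m)%:C%C * f m w * (f m w')^*].
Proof.
move=> sg1 swap.
pose P : mx R (M * A)%type (M * A)%type := fun w w' => \sum_x Psi x w * (Psi x w')^*.
have [|U [y [Uu PE]]] := @hermitian_spectral R _ P.
  move=> w w'; rewrite /P conjc_sum; apply: eq_bigr => x _.
  by rewrite conjcM conjcK mulrC.
have [f_on f_id] := unitary_columns Uu.
have spec w w' : \sum_x Psi x w * (Psi x w')^* =
    \sum_m (y m)%:C%C * U w m * (U w' m)^*.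
  have := congr1 (fun F => F w w') PE; rewrite /P /diag_conj => ->.
  by apply: eq_bigr => m _; rewrite [U w m * _]mulrC.
exists (fun z x => U x z), y; split=> // m.
have nsg : nrm2 sg = 1 by apply: complexI; rewrite nrm2E sg1.
transitivity (\sum_x nrm2 (dot (fun w => U w m) (Psi x))).
  rewrite /sqn /schmidt_vec.
  rewrite (reindex (fun x : A * L => (x.2, x.1)))/=; last first.
    by exists (fun x => (x.2, x.1)) => -[].
  apply: eq_bigr => -[a l] _ /=.
  rewrite -[RHS]mul1r -nsg -nrm2M; congr nrm2.
  rewrite /dot mulr_sumr; apply: eq_bigr => -[r c] _ /=.
  by rewrite swap mulrCA.
rewrite (reduced_weight _ spec) (bigD1 m)//= big1 ?addr0.
  by have := f_on m m; rewrite eqxx => ->; rewrite /nrm2 /= expr1n expr0n addr0 mulr1.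
by move=> m' /negbTE mm; have := f_on m m'; rewrite eq_sym mm => ->; rewrite nrm20 mulr0.
Qed.

Lemma sum_sigma (V : nmodType) (J : finType) (T : J -> finType)
    (F : forall j, T j -> V) :
  \sum_j \sum_(t : T j) F j t = \sum_(p : {j : J & T j}) F (tag p) (tagged p).
Proof. exact: (sig_big_dep xpredT (fun _ _ => true)). Qed.

Lemma sum3_prod (S T V : finType) (F : S -> T -> V -> R) :
  \sum_a \sum_b \sum_c F a b c = \sum_(p : (S * (T * V))%type) F p.1 p.2.1 p.2.2.
Proof.
by rewrite [RHS]sum_pair; apply: eq_bigr => a _; rewrite [RHS]sum_pair.
Qed.

(* [L j] and [M j] index b_j^L and b_j^R, [G j] is the operator W_j^* V_B, and
   [nu j] lists the eigenvalues of p_j tau_j.  The families [u j], [v j] are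
   eigenvectors pulled back by V_A, V_C: they are no longer orthonormal, only
   resolutions of the identity. *)
Lemma entropy_le_block_divergence (A B J : finType) (L M I K : J -> finType)
    (psi : vec R (A * B * A)%type) (sg : C)
    (h : A -> vec R A) (lam : A -> R)
    (G : forall j, L j -> M j -> B -> C)
    (u : forall j, I j -> vec R (A * L j)%type)
    (v : forall j, K j -> vec R (M j * A)%type)
    (s : forall j, I j -> R) (nu : forall j, K j -> R) :
  let Psi j (x : A * L j) (w : M j * A) := \sum_b G j x.2 w.1 b * psi (x.1, b, w.2) in
  let wt j i k := nrm2 (dot (v j k) (fun w => dot (u j i) (fun x => Psi j x w))) in
  sg * sg^* = 1 -> (forall a b c, psi (c, b, a) = sg * psi (a, b, c)) ->
  orthonormal_fam h -> resolves_id h ->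
  (forall a a', \sum_b \sum_c psi (a, b, c) * (psi (a', b, c))^* =
                \sum_e (lam e)%:C%C * h e a * (h e a')^*) ->
  \sum_e lam e = 1 ->
  (forall phi : vec R B, \sum_j \sum_l \sum_r nrm2 (\sum_b G j l r b * phi b) = sqn phi) ->
  (forall j, resolves_id (u j)) -> (forall j, resolves_id (v j)) ->
  (forall j i, 0 <= s j i) -> (forall j, \sum_i s j i <= 1) ->
  (forall j k, 0 <= nu j k) -> \sum_j \sum_k nu j k <= 1 ->
  (forall j i k, s j i * nu j k = 0 -> wt j i k = 0) ->
  \sum_j \sum_i \sum_k wt j i k * ln (s j i * nu j k) <= \sum_e lam e * ln (lam e).
Proof.
move=> Psi wt sg1 swap h_on h_id rho lam1 G_iso u_id v_id s0 s1 nu0 nu1 supp.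
pose phi e : vec R (A * B)%type := fun p => dot (h e) (fun c => psi (p.1, p.2, c)).
(* [rho] describes system A. By the exchange it describes C as well, so the components of psi along
   the [h e] on C are orthogonal with squared norms [lam e]. *)
have phi_dot e e' : dot (phi e) (phi e') = (lam e)%:C%C * (e == e')%:R.
  pose T (p : A * B) : vec R A := fun c => psi (c, p.2, p.1).
  have phiE g p : phi g p = sg * dot (h g) (T p).
    rewrite /phi /dot mulr_sumr; apply: eq_bigr => c _; rewrite /T.
    by rewrite (swap c p.2 p.1) mulrCA.
  have spec c c' : \sum_p T p c * (T p c')^* = \sum_g (lam g)%:C%C * h g c * (h g c')^*.
    by rewrite sum_pair exchange_big -rho.
  transitivity (\sum_p dot (h e') (T p) * (dot (h e) (T p))^*).
    apply: eq_bigr => p _; rewrite !phiE conjcM.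
    by rewrite -[RHS]mul1r -sg1; ring.
  rewrite (reduced_form _ _ spec) (bigD1 e)//= big1 ?addr0.
    by rewrite !h_on eqxx conjc1 mulr1 eq_sym.
  by move=> g /negbTE ge; rewrite !h_on [e == g]eq_sym ge conjc0 mulr0.
have phi_comb c : sqn (fun p => \sum_e c e * phi e p) = \sum_e lam e * nrm2 (c e).
  apply: complexI; rewrite sqnE raddf_sum /dot /=.
  under eq_bigr => p _ do rewrite conjc_sum mulr_suml.
  rewrite exchange_big; apply: eq_bigr => e _ /=.
  transitivity (\sum_e' (c e)^* * c e' * dot (phi e) (phi e')).
    under [RHS]eq_bigr => e' _ do rewrite /dot mulr_sumr.
    rewrite [RHS]exchange_big; apply: eq_bigr => p _ /=.
    by rewrite mulr_sumr; apply: eq_bigr => e' _; rewrite conjcM; ring.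
  rewrite (bigD1 e)//= big1 ?addr0; last first.
    by move=> g /negbTE ge; rewrite phi_dot eq_sym ge !mulr0.
  by rewrite phi_dot eqxx rmorphM /= nrm2E; ring.
pose a j i r e := amp (u j) h (Psi j) i r e.
have condE j e q : cond_vec (Psi j) h e q =
    \sum_b G j q.1 q.2.1 b * phi e (q.2.2, b).
  rewrite /cond_vec /Psi /phi /dot /=.
  under eq_bigr => c _ do rewrite mulr_sumr.
  rewrite exchange_big; apply: eq_bigr => b _ /=; rewrite mulr_sumr.
  by apply: eq_bigr => c _; rewrite mulrCA.
have G_sum (Phi : vec R (A * B)%type) :
    \sum_j \sum_(q : (L j * (M j * A))%type)
      nrm2 (\sum_b G j q.1 q.2.1 b * Phi (q.2.2, b)) = sqn Phi.
  rewrite /sqn [RHS]sum_pair.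
  transitivity (\sum_j \sum_a \sum_l \sum_r nrm2 (\sum_b G j l r b * Phi (a, b))).
    apply: eq_bigr => j _; rewrite sum_pair [RHS]exchange_big; apply: eq_bigr => l _ /=.
    by rewrite sum_pair exchange_big.
  rewrite exchange_big; apply: eq_bigr => a' _ /=.
  exact: (G_iso (fun b => Phi (a', b))).
(* Summed over all blocks the left side would equal the right one, since G is an isometry and the
   [phi e] are orthogonal; one block is one nonnegative term of that sum. *)
have contr j c : sqn (fun q => \sum_e c e * cond_vec (Psi j) h e q) <=
    \sum_e lam e * nrm2 (c e).
  rewrite -phi_comb -G_sum (bigD1 j)//=.
  rewrite [X in X <= _](_ : _ = \sum_(q : (L j * (M j * A))%type)
     nrm2 (\sum_b G j q.1 q.2.1 b * \sum_e c e * phi e (q.2.2, b))).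
    rewrite lerDl; apply: sumr_ge0 => j' _; apply: sumr_ge0 => q _.
    exact: nrm2_ge0.
  apply: eq_bigr => q _; congr nrm2.
  under eq_bigr => e _ do rewrite condE mulr_sumr.
  rewrite exchange_big; apply: eq_bigr => b _ /=; rewrite mulr_sumr.
  by apply: eq_bigr => e _; rewrite mulrCA.
have lamE e : \sum_j \sum_i \sum_r nrm2 (a j i r e) = lam e.
  transitivity (sqn (phi e)); last first.
    by apply: complexI; rewrite sqnE phi_dot eqxx mulr1.
  rewrite -G_sum; apply: eq_bigr => j _.
  transitivity (\sum_r \sum_a' \sum_l nrm2 (cond_vec (Psi j) h e (l, (r, a')))); last first.
    symmetry; rewrite sum_pair exchange_big /= sum_pair.
    by do 3 (apply: eq_bigr => ? _); rewrite condE.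
  rewrite exchange_big.
    apply: eq_bigr => r _.
    rewrite /a /amp; under eq_bigr => i _ do rewrite dot_exchange.
    by rewrite parseval// /sqn sum_pair.
have swapP j a' l r c : Psi j (c, l) (r, a') = sg * Psi j (a', l) (r, c).
  by rewrite /Psi mulr_sumr; apply: eq_bigr => b _ /=; rewrite swap mulrCA.
pose f j := sval (cid (block_spectrum sg1 (swapP j))).
pose y j := sval (cid (svalP (cid (block_spectrum sg1 (swapP j))))).
have fy j : [/\ orthonormal_fam (f j), resolves_id (f j),
    forall m, sqn (schmidt_vec (Psi j) (f j) m) = y j m &
    forall w w', \sum_x Psi j x w * (Psi j x w')^* =
                 \sum_m (y j m)%:C%C * f j m w * (f j m w')^*].
  exact: svalP (cid (svalP (cid (block_spectrum sg1 (swapP j))))).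
have y0 j m : 0 <= y j m by have [_ _ yE _] := fy j; rewrite -yE sqn_ge0.
have lam0 e : 0 <= lam e.
  by rewrite -lamE; do 3 (apply: sumr_ge0 => ? _); apply: nrm2_ge0.
have n0 := @nrm2_ge0 R.
(* [W] and [N] are the marginals of the joint weights [wt] that go with the eigenvalues [s] and [nu]
   respectively. *)
pose W j i := \sum_r \sum_e nrm2 (a j i r e).
have WE j i : W j i = \sum_k wt j i k.
  rewrite /wt parseval// /W /sqn sum_pair; apply: eq_bigr => r _.
  by rewrite /a /amp parseval.
pose N j k := \sum_x nrm2 (dot (v j k) (Psi j x)).
have NE j k : N j k = \sum_i wt j i k.
  rewrite /wt; under eq_bigr => i _ do rewrite dot_exchange.
  by rewrite parseval// /sqn; apply: eq_bigr => x _; rewrite /= dot_exchange.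
have sum_y j : \sum_m y j m = \sum_i W j i.
  rewrite /W /a amp_sqn//.
  have [f_on f_id yE spec] := fy j.
  rewrite sum_exchange_factors [RHS]exchange_big /=.
  under eq_bigr => m _ do rewrite -yE /sqn.
  rewrite exchange_big; apply: eq_bigr => q _ /=.
  by rewrite /schmidt_vec parseval.
have rot (F : forall j, I j -> M j -> A -> R) :
    \sum_j \sum_i \sum_r \sum_e F j i r e = \sum_e \sum_j \sum_i \sum_r F j i r e.
  rewrite [RHS]exchange_big; apply: eq_bigr => j _ /=.
  rewrite [RHS]exchange_big; apply: eq_bigr => i _ /=.
  by rewrite [RHS]exchange_big.
have lam_sum : \sum_e lam e = \sum_j \sum_i W j i.
  by rewrite /W rot; apply: eq_bigr => e _; rewrite lamE.
have a_supp j i r e : nrm2 (a j i r e) != 0 -> 0 < s j i /\ 0 < lam e.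
  move=> aN0; have a_gt0 : 0 < nrm2 (a j i r e) by rewrite lt_def aN0 n0.
  split.
    rewrite lt_def s0 andbT; apply: contraTneq a_gt0 => si0.
    have : W j i = 0 by rewrite WE big1// => k _; apply: supp; rewrite si0 mul0r.
    rewrite /W (bigD1 r)//= (bigD1 e)//= => W0.
    rewrite -leNgt -W0.
    by do 2 (apply: ler_wpDr; first by repeat (apply: sumr_ge0 => ? _)).
  apply: (lt_le_trans a_gt0); rewrite -lamE (bigD1 j)//= (bigD1 i)//= (bigD1 r)//=.
  by do 3 (apply: ler_wpDr; first by repeat (apply: sumr_ge0 => ? _)).
(* The form of S(XYZ) <= S(XY) + S(YZ): all blocks are merged into one sum, with weights |a|^2 at
   the points s / lam against weights y at the points 1 / y. *)
have resolvent : \sum_j \sum_i \sum_r \sum_e nrm2 (a j i r e) * ln (s j i / lam e) <=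
    \sum_j \sum_m y j m * ln (y j m)^-1.
  under eq_bigr => j _ do rewrite sum3_prod.
  rewrite !sum_sigma; apply: ln_ge_sum_resolvent.
  - by move=> p; apply: nrm2_ge0.
  - by move=> p /a_supp[? ?]; rewrite divr_gt0.
  - by move=> p; apply: y0.
  - by move=> p yN0; rewrite invr_gt0 lt_def yN0 y0.
  - rewrite -(sum_sigma (fun j (p : I j * (M j * A)) => nrm2 (a j p.1 p.2.1 p.2.2))) -(sum_sigma y).
    by apply: eq_bigr => j _; rewrite sum_y /W sum3_prod.
  - move=> t t0.
    rewrite -(sum_sigma (fun j (p : I j * (M j * A)) => nrm2 (a j p.1 p.2.1 p.2.2) / (s j p.1 / lam p.2.2 + t))).
    rewrite -(sum_sigma (fun j m => y j m / ((y j m)^-1 + t))).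
    apply: ler_sum => j _; have [f_on f_id yE spec] := fy j.
    rewrite -(sum3_prod (fun i r e => nrm2 (a j i r e) / (s j i / lam e + t))).
    exact: block_resolvent f_on yE (u_id j) h_id (s0 j) (s1 j) lam0 (contr j) t0.
have resolventE : \sum_j \sum_i \sum_r \sum_e nrm2 (a j i r e) * ln (s j i / lam e) =
    \sum_j \sum_i W j i * ln (s j i) - \sum_e lam e * ln (lam e).
  transitivity (\sum_j \sum_i \sum_r \sum_e
      (nrm2 (a j i r e) * ln (s j i) - nrm2 (a j i r e) * ln (lam e))).
    do 4 (apply: eq_bigr => ? _).
    set w := nrm2 _; have [->|/a_supp[? ?]] := eqVneq w 0; first by rewrite !mul0r subrr.
    by rewrite ln_div ?posrE// mulrBr.
  transitivity (\sum_j \sum_i \sum_r \sum_e nrm2 (a j i r e) * ln (s j i) -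
      \sum_j \sum_i \sum_r \sum_e nrm2 (a j i r e) * ln (lam e)).
    symmetry; do 3 (rewrite -sumrB; apply: eq_bigr => ? _).
    by rewrite -sumrB.
  congr (_ - _).
    apply: eq_bigr => j _; apply: eq_bigr => i _; rewrite /W mulr_suml.
    by apply: eq_bigr => r _; rewrite mulr_suml.
  rewrite rot; apply: eq_bigr => e _; rewrite -[in RHS]lamE mulr_suml.
  apply: eq_bigr => j _; rewrite mulr_suml; apply: eq_bigr => i _.
  by rewrite mulr_suml; apply: eq_bigr => r _; rewrite lamE.
have klein : \sum_j \sum_k N j k * ln (nu j k) <= \sum_j \sum_m y j m * ln (y j m).
  apply: (@le_trans _ _ (\sum_j (\sum_m y j m * ln (y j m) + \sum_k nu j k - \sum_m y j m))).
    apply: ler_sum => j _; have [f_on f_id yE spec] := fy j.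
    apply: (block_klein f_on f_id (y0 j) spec (v_id j) (nu0 j)) => k nuk.
    by rewrite -/(N j k) NE big1// => i _; apply: supp; rewrite nuk mulr0.
  (* The corrections sum nu - sum y have no sign in a single block. Over all blocks the first total
     is at most 1 and the second is exactly 1. *)
  rewrite sumrB big_split /= -addrA gerDl subr_le0 (le_trans nu1)//.
  by rewrite -lam1 lam_sum; under [X in _ <= X]eq_bigr do rewrite sum_y.
(* The logarithm of a product splits only at nonzero eigenvalues; the other terms carry weight 0 by
   the support condition. *)
have wtE : \sum_j \sum_i \sum_k wt j i k * ln (s j i * nu j k) =
    \sum_j \sum_i W j i * ln (s j i) + \sum_j \sum_k N j k * ln (nu j k).
  rewrite -big_split; apply: eq_bigr => j _ /=.
  under [X in _ = X + _]eq_bigr => i _ do rewrite WE mulr_suml.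
  under [X in _ = _ + X]eq_bigr => k _ do rewrite NE mulr_suml.
  rewrite [X in _ = _ + X]exchange_big -big_split; apply: eq_bigr => i _ /=.
  rewrite -big_split; apply: eq_bigr => k _ /=.
  have [->|wN0] := eqVneq (wt j i k) 0; first by rewrite !mul0r addr0.
  have : s j i * nu j k != 0.
    by apply: contra_neq wN0 => /supp.
  rewrite mulf_eq0 negb_or => /andP[sN0 nuN0].
  by rewrite lnM ?posrE ?lt_def ?sN0 ?nuN0 ?s0 ?nu0// mulrDr.
have ylnV : \sum_j \sum_m y j m * ln (y j m)^-1 = - \sum_j \sum_m y j m * ln (y j m).
  rewrite -sumrN; apply: eq_bigr => j _; rewrite -sumrN; apply: eq_bigr => m _.
  have [->|yN0] := eqVneq (y j m) 0; first by rewrite !mul0r oppr0.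
  by rewrite lnV ?posrE ?lt_def ?yN0 ?y0// mulrN.
move: resolvent; rewrite resolventE ylnV wtE; move: klein; lra.
Qed.
End Core.

(** * Eigenvectors and functional calculus *)

Section FunctionalCalculus.
Variable R : realType.
Local Notation C := R[i].
Local Notation "z ^*" := (conjc z) : ring_scope.

(** In Parseval's identity for the unit vector [g j] the j-th term is already 1, so all other
    overlaps vanish. *)
Lemma resolves_unit_orthonormal (I T : finType) (g : I -> vec R T) :
  resolves_id g -> (forall i, sqn (g i) = 1) -> orthonormal_fam g.
Proof.
move=> gid g1 i j; have [<-|/negbTE ij] := eqVneq i j.
  by rewrite -sqnE g1.
have := parseval (g j) gid; rewrite g1 (bigD1 j)//= -sqnE nrm2_real g1 expr1n.
move=> /eqP; rewrite -subr_eq0 addrAC subrr add0r => /eqP /psumr_eq0P h.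
by apply/eqP; rewrite -nrm2_eq0 h ?ij// => k _; apply: nrm2_ge0.
Qed.

Definition eigenvec (T : finType) (A : mx R T T) (k : R) (g : vec R T) : Prop :=
  forall x, apply A g x = k%:C%C * g x.

Lemma apply_diag_conj (T : finType) (U : mx R T T) (lam : T -> R) (g : vec R T) x :
  apply (diag_conj U lam) g x = \sum_z U x z * (lam z)%:C%C * dot (U^~ z) g.
Proof.
rewrite /apply /diag_conj; under eq_bigr => y _ do rewrite mulr_suml.
rewrite exchange_big; apply: eq_bigr => z _; rewrite /dot mulr_sumr.
by apply: eq_bigr => y _; rewrite mulrA.
Qed.

Lemma dot_columns_diag_conj (T : finType) (U : mx R T T) (lam : T -> R) g z :
  unitary U -> dot (U^~ z) (apply (diag_conj U lam) g) = (lam z)%:C%C * dot (U^~ z) g.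
Proof.
move=> /unitary_columns [Uon _].
rewrite {1}/dot; under eq_bigr => x _ do rewrite apply_diag_conj mulr_sumr.
rewrite exchange_big /= (bigD1 z)//= [X in _ + X]big1 ?addr0.
  have := Uon z z; rewrite eqxx /dot => h.
  transitivity ((\sum_x (U x z)^* * U x z) * ((lam z)%:C%C * dot (U^~ z) g)).
    by rewrite mulr_suml; apply: eq_bigr => x _; rewrite !mulrA.
  by rewrite h mul1r.
move=> z' /negbTE zz'.
transitivity ((\sum_x (U x z)^* * U x z') * ((lam z')%:C%C * dot (U^~ z') g)).
  by rewrite mulr_suml; apply: eq_bigr => x _; rewrite !mulrA.
by have := Uon z z'; rewrite /dot eq_sym zz' => ->; rewrite mul0r.
Qed.

Lemma spectral_coef (T : finType) (A U : mx R T T) (lam : T -> R) k g z :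
  spectral A U lam -> eigenvec A k g -> dot (U^~ z) g != 0 -> lam z = k.
Proof.
move=> [Uu AE] gk dN0; apply: complexI; apply: (mulIf dN0).
rewrite -dot_columns_diag_conj// -AE /dot mulr_sumr.
by apply: eq_bigr => x _; rewrite gk mulrCA.
Qed.

(** Only columns of eigenvalue k overlap with [g], and on those L acts as [F k]. Hence the value of
    L on eigenvectors does not depend on the decomposition hidden in [fcalc]. *)
Lemma fcalc_eigenvec (T : finType) (F : R -> R) (A L : mx R T T) k g :
  fcalc F A L -> eigenvec A k g -> eigenvec L (F k) g.
Proof.
move=> [U [lam [sp ->]]] gk x; rewrite apply_diag_conj.
have [_ Uid] := unitary_columns sp.1.
rewrite (resolves_id_expand g x Uid) mulr_sumr; apply: eq_bigr => z _.
have [->|/(spectral_coef sp gk) lamk] := eqVneq (dot (U^~ z) g) 0.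
  by rewrite !mulr0.
by rewrite /= lamk mulrAC mulrC.
Qed.

Lemma spectral_eigenvec (T : finType) (A U : mx R T T) (lam : T -> R) z :
  spectral A U lam -> eigenvec A (lam z) (U^~ z).
Proof.
move=> [Uu ->] x; rewrite apply_diag_conj.
have [Uon _] := unitary_columns Uu.
rewrite (bigD1 z)//= big1 ?addr0; last first.
  by move=> z' /negbTE zz; rewrite Uon zz mulr0.
by rewrite Uon eqxx mulr1 mulrC.
Qed.

Lemma dot_apply_eigenfam (I T : finType) (L : mx R T T) (k : I -> R)
    (g : I -> vec R T) (phi : vec R T) :
  resolves_id g -> (forall i, eigenvec L (k i) (g i)) ->
  dot phi (apply L phi) = (\sum_i k i * nrm2 (dot (g i) phi))%:C%C.
Proof.
move=> gid gk.
have Lphi x : apply L phi x = \sum_i (k i)%:C%C * g i x * dot (g i) phi.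
  rewrite /apply; under eq_bigr => y _ do rewrite (resolves_id_expand phi y gid) mulr_sumr.
  rewrite exchange_big; apply: eq_bigr => i _ /=.
  rewrite -gk /apply mulr_suml; apply: eq_bigr => y _; exact: mulrA.
rewrite {1}/dot; under eq_bigr => x _ do rewrite Lphi mulr_sumr.
rewrite exchange_big raddf_sum; apply: eq_bigr => i _ /=.
rewrite rmorphM /= nrm2E dotC mulrA [dot phi (g i)]/dot mulr_sumr.
by apply: eq_bigr => x _; ring.
Qed.

Lemma trace_pure (T : finType) (phi : vec R T) (M : mx R T T) :
  trace (mxmul (pure_dm phi) M) = dot phi (apply M phi).
Proof.
rewrite /trace /mxmul /pure_dm exchange_big; apply: eq_bigr => y _.
by rewrite /apply mulr_sumr; apply: eq_bigr => x _; ring.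
Qed.

Lemma trace_spectral (T : finType) (F : R -> R) (A L U : mx R T T) (lam : T -> R) :
  spectral A U lam -> fcalc F A L ->
  trace (mxmul A L) = (\sum_z lam z * F (lam z))%:C%C.
Proof.
move=> sp fL; have [Uu AE] := sp.
have [Uon _] := unitary_columns Uu.
rewrite raddf_sum /trace /mxmul.
transitivity (\sum_x \sum_y \sum_z (lam z)%:C%C * ((U y z)^* * L y x * U x z)).
  apply: eq_bigr => x _; apply: eq_bigr => y _; rewrite {1}AE /diag_conj mulr_suml.
  by apply: eq_bigr => z _; ring.
under eq_bigr => x _ do rewrite exchange_big.
rewrite exchange_big; apply: eq_bigr => z _ /=.
rewrite exchange_big rmorphM /=.
transitivity ((lam z)%:C%C * dot (U^~ z) (apply L (U^~ z))).
  rewrite /dot mulr_sumr; apply: eq_bigr => y _; rewrite /apply !mulr_sumr.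
  by apply: eq_bigr => x _; ring.
congr (_ * _); rewrite /dot.
under eq_bigr => x _ do rewrite (fcalc_eigenvec fL (spectral_eigenvec z sp)) mulrCA.
by rewrite -mulr_sumr; have := Uon z z; rewrite /dot eqxx => ->; rewrite mulr1.
Qed.

(** The value of [slog2] at 0 agrees with the convention [ln 0 = 0]. *)
Lemma slog2E (x : R) : slog2 x = ln x / ln 2.
Proof. by rewrite /slog2 /log2; case: eqP => // ->; rewrite ln0// mul0r. Qed.

(** Every choice of logarithm gives the same trace, so the infimum runs over a singleton; it is
    nonempty thanks to the given decomposition. *)
Lemma vN_entropy_spectral (T : finType) (A U : mx R T T) (lam : T -> R) :
  spectral A U lam ->
  vN_entropy A = ((- \sum_z lam z * ln (lam z)) / ln 2)%:E.
Proof.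
move=> sp.
have valE L : fcalc (@slog2 R) A L -> - complex.Re (trace (mxmul A L)) =
    (- \sum_z lam z * ln (lam z)) / ln 2.
  move=> fL; rewrite (trace_spectral sp fL) /= mulNr mulr_suml; congr (- _).
  by apply: eq_bigr => z _; rewrite slog2E mulrA.
rewrite /vN_entropy -[RHS]ereal_inf1; congr ereal_inf.
apply/seteqP; split => e /=.
  by move=> [L [fL ->]]; rewrite valE.
move=> ->; exists (diag_conj U (@slog2 R \o lam)).
have fL : fcalc (@slog2 R) A (diag_conj U (@slog2 R \o lam)) by exists U, lam.
by rewrite valE.
Qed.

Lemma psd_spectral_ge0 (T : finType) (A U : mx R T T) (lam : T -> R) z :
  psd A -> spectral A U lam -> 0 <= lam z.
Proof.
move=> [_ pA] sp; have [Uon _] := unitary_columns sp.1.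
have := pA (U^~ z).
have -> : \sum_x \sum_y (U x z)^* * A x y * U y z = (lam z)%:C%C.
  transitivity (dot (U^~ z) (apply A (U^~ z))).
    apply: eq_bigr => x _; rewrite /apply mulr_sumr.
    by apply: eq_bigr => y _; rewrite mulrA.
  rewrite /dot; under eq_bigr => x _ do rewrite (spectral_eigenvec z sp) mulrCA.
  by rewrite -mulr_sumr; have := Uon z z; rewrite /dot eqxx => ->; rewrite mulr1.
by rewrite ler0c.
Qed.

Lemma trace_diag_conj (T : finType) (U : mx R T T) (lam : T -> R) :
  unitary U -> trace (diag_conj U lam) = (\sum_z lam z)%:C%C.
Proof.
move=> /unitary_columns [Uon _].
rewrite /trace /diag_conj exchange_big raddf_sum; apply: eq_bigr => z _ /=.
transitivity ((lam z)%:C%C * dot (U^~ z) (U^~ z)).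
  by rewrite /dot mulr_sumr; apply: eq_bigr => x _; ring.
by rewrite Uon eqxx mulr1.
Qed.

Lemma density_spectral (T : finType) (A : mx R T T) : density A ->
  exists (U : mx R T T) (lam : T -> R),
    [/\ spectral A U lam, forall z, 0 <= lam z & \sum_z lam z = 1].
Proof.
move=> [pA tA]; have [U [lam sp]] := hermitian_spectral pA.1.
exists U, lam; split=> //; first by move=> z; apply: psd_spectral_ge0 pA sp.
by apply: complexI; rewrite -(trace_diag_conj lam sp.1) -sp.2.
Qed.

(** Serves for the reduced states of psi and for their product: each is a sum of |F n><F n| over the
    traced-out indices. *)
Lemma gram_density (T N : finType) (F : N -> vec R T) :
  \sum_n sqn (F n) = 1 ->
  density (fun w w' => \sum_n F n w * (F n w')^*).
Proof.
move=> F1; split; first split.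
- move=> w w'; rewrite conjc_sum; apply: eq_bigr => n _.
  by rewrite conjcM conjcK mulrC.
- move=> v.
  have -> : \sum_x \sum_y (v x)^* * (\sum_n F n x * (F n y)^*) * v y =
      (\sum_n nrm2 (dot v (F n)))%:C%C.
    rewrite raddf_sum /=.
    transitivity (\sum_x \sum_y \sum_n ((v x)^* * F n x) * ((F n y)^* * v y)).
      apply: eq_bigr => x _; apply: eq_bigr => y _; rewrite mulr_sumr mulr_suml.
      by apply: eq_bigr => n _; ring.
    transitivity (\sum_n \sum_x \sum_y ((v x)^* * F n x) * ((F n y)^* * v y)).
      rewrite [RHS]exchange_big; apply: eq_bigr => x _ /=.
      by rewrite [RHS]exchange_big.
    apply: eq_bigr => n _.
    rewrite nrm2E dotC /dot mulr_suml; apply: eq_bigr => x _.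
    by rewrite mulr_sumr.
  by rewrite ler0c sumr_ge0// => n _; apply: nrm2_ge0.
- rewrite /trace exchange_big -[RHS](rmorph1 (real_complex R)) -F1 raddf_sum.
  apply: eq_bigr => n _ /=; rewrite sqnE; apply: eq_bigr => x _; exact: mulrC.
Qed.

End FunctionalCalculus.

(** * Markov states and embeddings *)

Section Embeddings.
Variable R : realType.
Local Notation C := R[i].
Local Notation "z ^*" := (conjc z) : ring_scope.

Lemma isometryP (T U : finType) (V : mx R T U) :
  Defs.isometry V <-> orthonormal_fam (fun a x => V x a).
Proof.
split=> [h a b|h]; first exact: (congr1 (fun F => F a b) h).
by apply/funext => a; apply/funext => b; apply: h.
Qed.

Lemma isometry_sqn (T U : finType) (V : mx R T U) (c : vec R U) :
  Defs.isometry V -> \sum_x nrm2 (\sum_a V x a * c a) = sqn c.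
Proof.
move=> /isometryP Von; rewrite /sqn -(sqn_lincomb c Von).
by apply: eq_bigr => x _; congr nrm2; apply: eq_bigr => a _; rewrite mulrC.
Qed.

Lemma sum_delta (T : finType) (F : T -> C) (x : T) :
  \sum_y F y * (x == y)%:R = F x.
Proof.
rewrite (bigD1 x)//= eqxx mulr1 big1 ?addr0// => y /negbTE yx.
by rewrite eq_sym yx mulr0.
Qed.

(** The product vector a (x) b on X L M Z, carried to X Y Z by [W] acting on L M. *)
Definition block_vec (X Y Z L M : finType) (W : mx R Y (L * M)%type)
    (a : vec R (X * L)%type) (b : vec R (M * Z)%type) : vec R (X * Y * Z)%type :=
  fun w => \sum_q W w.1.2 q * (a (w.1.1, q.1) * b (q.2, w.2)).

(** Taken with weights 1 this yields completeness of the product eigenvectors, and with eigenvalues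
    it yields the Markov state itself. *)
Lemma block_vec_gram (X Y Z L M I K : finType) (W : mx R Y (L * M)%type)
    (g : I -> vec R (X * L)%type) (h : K -> vec R (M * Z)%type)
    (c : I -> C) (d : K -> C) w w' :
  \sum_i \sum_k c i * d k * (block_vec W (g i) (h k) w * (block_vec W (g i) (h k) w')^*) =
  \sum_q \sum_q' W w.1.2 q * (W w'.1.2 q')^* *
    ((\sum_i c i * g i (w.1.1, q.1) * (g i (w'.1.1, q'.1))^*) *
     (\sum_k d k * h k (q.2, w.2) * (h k (q'.2, w'.2))^*)).
Proof.
transitivity (\sum_i \sum_k \sum_q \sum_q' W w.1.2 q * (W w'.1.2 q')^* *
    ((c i * g i (w.1.1, q.1) * (g i (w'.1.1, q'.1))^*) *
     (d k * h k (q.2, w.2) * (h k (q'.2, w'.2))^*))).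
  apply: eq_bigr => i _; apply: eq_bigr => k _.
  rewrite /block_vec conjc_sum mulr_suml mulr_sumr; apply: eq_bigr => q _.
  rewrite !mulr_sumr; apply: eq_bigr => q' _.
  by rewrite !conjcM; ring.
under eq_bigr => i _ do rewrite exchange_big /=.
rewrite exchange_big; apply: eq_bigr => q _ /=.
under eq_bigr => i _ do rewrite exchange_big /=.
rewrite exchange_big; apply: eq_bigr => q' _ /=.
rewrite mulr_suml mulr_sumr; apply: eq_bigr => i _.
by rewrite !mulr_sumr.
Qed.

Lemma block_vec_sqn (X Y Z L M : finType) (W : mx R Y (L * M)%type)
    (a : vec R (X * L)%type) (b : vec R (M * Z)%type) :
  Defs.isometry W -> sqn (block_vec W a b) = sqn a * sqn b.
Proof.
move=> Wiso.
transitivity (\sum_x \sum_z \sum_l \sum_m nrm2 (a (x, l)) * nrm2 (b (m, z))).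
  rewrite /sqn sum_pair sum_pair; apply: eq_bigr => x _.
  rewrite exchange_big; apply: eq_bigr => z _ /=.
  rewrite -(sum_pair (fun q => nrm2 (a (x, q.1)) * nrm2 (b (q.2, z)))).
  rewrite (isometry_sqn (fun q => a (x, q.1) * b (q.2, z)) Wiso).
  by apply: eq_bigr => q _; rewrite nrm2M.
rewrite /sqn !sum_pair mulr_suml; apply: eq_bigr => x _.
rewrite exchange_big mulr_suml; apply: eq_bigr => l _ /=.
rewrite mulr_sumr exchange_big; apply: eq_bigr => m _ /=.
by rewrite mulr_sumr.
Qed.

(** Applying V^* on both sides of a resolution of 1 leaves V^* V = 1. The spectator index [l] is a
    separate argument so that both orders of the factors follow. *)
Lemma pullback_resolves (X A L I : finType) (V : mx R X A)
    (g : I -> X -> L -> C) :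
  Defs.isometry V ->
  (forall x l x' l', \sum_i g i x l * (g i x' l')^* = ((x == x') && (l == l'))%:R) ->
  forall a l a' l', \sum_i (\sum_x (V x a)^* * g i x l) * (\sum_x (V x a')^* * g i x l')^* =
                    ((a == a') && (l == l'))%:R.
Proof.
move=> /isometryP Von gid a l a' l'.
transitivity (\sum_x \sum_x' (V x a)^* * V x' a' * \sum_i g i x l * (g i x' l')^*).
  transitivity (\sum_i \sum_x \sum_x' (V x a)^* * V x' a' * (g i x l * (g i x' l')^*)).
    apply: eq_bigr => i _; rewrite mulr_suml; apply: eq_bigr => x _.
    rewrite conjc_sum mulr_sumr; apply: eq_bigr => x' _.
    by rewrite conjcM conjcK; ring.
  rewrite exchange_big; apply: eq_bigr => x _ /=; rewrite exchange_big.
  by apply: eq_bigr => x' _; rewrite mulr_sumr.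
transitivity (\sum_x (V x a)^* * V x a' * (l == l')%:R).
  apply: eq_bigr => x _; rewrite -[RHS](sum_delta (fun x' => (V x a)^* * V x' a' * (l == l')%:R)).
  apply: eq_bigr => x' _; rewrite gid -[RHS]mulrA; congr (_ * _).
  by rewrite -natrM mulnb andbC.
rewrite -mulr_suml; have := Von a a'; rewrite /dot => ->.
by rewrite -natrM mulnb.
Qed.

Lemma resolves_pullbackl (X A L I : finType) (V : mx R X A) (g : I -> vec R (X * L)%type) :
  Defs.isometry V -> resolves_id g ->
  resolves_id (fun i (q : A * L) => \sum_x (V x q.1)^* * g i (x, q.2)).
Proof.
move=> Viso gid [a l] [a' l']; rewrite xpair_eqE.
apply: (pullback_resolves (g := fun i x l => g i (x, l)) Viso) => x m x' m'.
by rewrite gid xpair_eqE.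
Qed.

Lemma resolves_pullbackr (X A L I : finType) (V : mx R X A) (g : I -> vec R (L * X)%type) :
  Defs.isometry V -> resolves_id g ->
  resolves_id (fun i (q : L * A) => \sum_x (V x q.2)^* * g i (q.1, x)).
Proof.
move=> Viso gid [l a] [l' a']; rewrite xpair_eqE andbC.
apply: (pullback_resolves (g := fun i x l => g i (l, x)) Viso) => x m x' m'.
by rewrite gid xpair_eqE andbC.
Qed.

Lemma embed3_sqn (X Y Z X' Y' Z' : finType) (VX : mx R X' X) (VY : mx R Y' Y)
    (VZ : mx R Z' Z) (psi : vec R (X * Y * Z)%type) :
  Defs.isometry VX -> Defs.isometry VY -> Defs.isometry VZ ->
  sqn (embed3 VX VY VZ psi) = sqn psi.
Proof.
move=> hX hY hZ.
rewrite /sqn !sum_pair.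
transitivity (\sum_x' \sum_y' \sum_z' nrm2 (\sum_x VX x' x * (\sum_y VY y' y * (\sum_z VZ z' z * psi (x, y, z))))).
  do 3 (apply: eq_bigr => ? _); congr nrm2; rewrite /embed3 /=.
  apply: eq_bigr => x _; rewrite mulr_sumr; apply: eq_bigr => y _.
  by rewrite !mulr_sumr; apply: eq_bigr => z _; ring.
rewrite exchange_big /=.
under eq_bigr => y' _ do rewrite exchange_big /=.
under eq_bigr => y' _ do under eq_bigr => z' _ do rewrite isometry_sqn//.
rewrite exchange_big /=.
under eq_bigr => z' _ do rewrite exchange_big /=.
under eq_bigr => z' _ do under eq_bigr => x _ do rewrite isometry_sqn//.
rewrite exchange_big; apply: eq_bigr => x _ /=.
rewrite exchange_big; apply: eq_bigr => y _ /=.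
exact: isometry_sqn.
Qed.

(** All embeddings are moved by adjunction: those of the outer systems onto the eigenvectors, that
    of Y into the single operator W^* VY. Overlaps on the enlarged systems thus become overlaps with
    the original psi. *)
Lemma dot_block_vec_embed3 (X Y Z X' Y' Z' L M : finType) (VX : mx R X' X)
    (VY : mx R Y' Y) (VZ : mx R Z' Z) (psi : vec R (X * Y * Z)%type)
    (W : mx R Y' (L * M)%type) (a : vec R (X' * L)%type) (b : vec R (M * Z')%type) :
  dot (block_vec W a b) (embed3 VX VY VZ psi) =
  dot (fun w : M * Z => \sum_z (VZ z w.2)^* * b (w.1, z))
    (fun w => dot (fun x : X * L => \sum_x' (VX x' x.1)^* * a (x', x.2))
      (fun x => \sum_y (\sum_y' (W y' (x.2, w.1))^* * VY y' y) * psi (x.1, y, w.2))).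
Proof.
pose P x l m z := \sum_y (\sum_y' (W y' (l, m))^* * VY y' y) * psi (x, y, z).
transitivity (\sum_l \sum_m \sum_x' \sum_z' (a (x', l))^* * (b (m, z'))^* *
    \sum_x \sum_z VX x' x * VZ z' z * P x l m z).
  have partial l m x' z' : \sum_y' (W y' (l, m))^* * embed3 VX VY VZ psi (x', y', z') =
      \sum_x \sum_z VX x' x * VZ z' z * P x l m z.
    transitivity (\sum_y' \sum_x \sum_y \sum_z
        VX x' x * VZ z' z * ((W y' (l, m))^* * VY y' y * psi (x, y, z))).
      apply: eq_bigr => y' _; rewrite /embed3 mulr_sumr; apply: eq_bigr => x _.
      rewrite mulr_sumr; apply: eq_bigr => y _; rewrite mulr_sumr.
      by apply: eq_bigr => z _ /=; ring.
    rewrite exchange_big; apply: eq_bigr => x _ /=.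
    transitivity (\sum_z \sum_y \sum_y'
        VX x' x * VZ z' z * ((W y' (l, m))^* * VY y' y * psi (x, y, z))).
      rewrite exchange_big [RHS]exchange_big; apply: eq_bigr => y _ /=.
      by rewrite exchange_big.
    apply: eq_bigr => z _; rewrite /P mulr_sumr; apply: eq_bigr => y _.
    by rewrite mulr_suml mulr_sumr.
  transitivity (\sum_l \sum_m \sum_x' \sum_z' (a (x', l))^* * (b (m, z'))^* *
     \sum_y' (W y' (l, m))^* * embed3 VX VY VZ psi (x', y', z')); last first.
    by do 4 (apply: eq_bigr => ? _); rewrite partial.
  transitivity (\sum_x' \sum_y' \sum_z' \sum_l \sum_m (a (x', l))^* * (b (m, z'))^* *
     ((W y' (l, m))^* * embed3 VX VY VZ psi (x', y', z'))).
    rewrite /dot !sum_pair.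
    do 3 (apply: eq_bigr => ? _); rewrite /block_vec conjc_sum mulr_suml sum_pair.
    by do 2 (apply: eq_bigr => ? _); rewrite !conjcM /=; ring.
  transitivity (\sum_x' \sum_z' \sum_l \sum_m \sum_y' (a (x', l))^* * (b (m, z'))^* *
     ((W y' (l, m))^* * embed3 VX VY VZ psi (x', y', z'))).
    apply: eq_bigr => x' _; rewrite exchange_big; apply: eq_bigr => z' _ /=.
    rewrite exchange_big; apply: eq_bigr => l _ /=; exact: exchange_big.
  transitivity (\sum_l \sum_x' \sum_z' \sum_m \sum_y' (a (x', l))^* * (b (m, z'))^* *
     ((W y' (l, m))^* * embed3 VX VY VZ psi (x', y', z'))).
    rewrite [RHS]exchange_big; apply: eq_bigr => x' _ /=; exact: exchange_big.
  apply: eq_bigr => l _; rewrite [RHS]exchange_big; apply: eq_bigr => x' _ /=.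
  rewrite [RHS]exchange_big; apply: eq_bigr => z' _ /=; apply: eq_bigr => m _.
  by rewrite mulr_sumr.
transitivity (\sum_m \sum_z \sum_x \sum_l (\sum_z' VZ z' z * (b (m, z'))^*) *
    ((\sum_x' VX x' x * (a (x', l))^*) * P x l m z)); last first.
  rewrite /dot sum_pair; apply: eq_bigr => m _; apply: eq_bigr => z _ /=.
  rewrite conjc_sum; under [X in _ = X * _]eq_bigr do rewrite conjcM conjcK.
  rewrite sum_pair mulr_sumr; apply: eq_bigr => x _; rewrite mulr_sumr.
  apply: eq_bigr => l _; congr (_ * (_ * _)); rewrite conjc_sum.
  by apply: eq_bigr => x' _; rewrite conjcM conjcK.
transitivity (\sum_l \sum_m \sum_z \sum_x (\sum_z' VZ z' z * (b (m, z'))^*) *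
    ((\sum_x' VX x' x * (a (x', l))^*) * P x l m z)); last first.
  rewrite exchange_big; apply: eq_bigr => m _ /=.
  rewrite exchange_big; apply: eq_bigr => z _ /=; exact: exchange_big.
apply: eq_bigr => l _; apply: eq_bigr => m _.
transitivity (\sum_x' \sum_z' \sum_x \sum_z
   (VZ z' z * (b (m, z'))^*) * ((VX x' x * (a (x', l))^*) * P x l m z)).
  do 2 (apply: eq_bigr => ? _); rewrite mulr_sumr; apply: eq_bigr => x _.
  by rewrite mulr_sumr; apply: eq_bigr => z _; ring.
transitivity (\sum_z \sum_x \sum_z' \sum_x'
   (VZ z' z * (b (m, z'))^*) * ((VX x' x * (a (x', l))^*) * P x l m z)).
  rewrite exchange_big /=.
  transitivity (\sum_z' \sum_x \sum_z \sum_x'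
   (VZ z' z * (b (m, z'))^*) * ((VX x' x * (a (x', l))^*) * P x l m z)).
    apply: eq_bigr => z' _; rewrite exchange_big; apply: eq_bigr => x _ /=.
    exact: exchange_big.
  rewrite exchange_big [RHS]exchange_big; apply: eq_bigr => x _ /=; exact: exchange_big.
apply: eq_bigr => z _; apply: eq_bigr => x _; rewrite mulr_suml; apply: eq_bigr => z' _.
by rewrite mulr_suml mulr_sumr.
Qed.
End Embeddings.

(** * Exchange symmetry of psi and eigenvectors of Markov states *)

Section MarkovSpectrum.
Variable R : realType.
Local Notation C := R[i].
Local Notation "z ^*" := (conjc z) : ring_scope.

Lemma apply_delta (T U : finType) (A : mx R T U) (y : U) x :
  apply A (fun z => (y == z)%:R) x = A x y.
Proof. exact: sum_delta. Qed.

(** The squared norm over b of psi(c,b,a) - sg psi(a,b,c) expands into four entries of rho_AC, which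
    cancel in pairs by the support condition. *)
Lemma swap_of_support (A B : finType) (psi : vec R (A * B * A)%type) (sg : C) :
  sg^* = sg -> sg * sg = 1 ->
  (forall v a c, apply (ptr_Y (pure_dm psi)) v (a, c) =
                 sg * apply (ptr_Y (pure_dm psi)) v (c, a)) ->
  forall a b c, psi (c, b, a) = sg * psi (a, b, c).
Proof.
move=> sgR sg1 supp a b c.
pose rho := ptr_Y (pure_dm psi).
have rhoE a1 c1 v : rho (a1, c1) v = sg * rho (c1, a1) v.
  by rewrite -!apply_delta; apply: supp.
have h : \sum_b nrm2 (psi (c, b, a) - sg * psi (a, b, c)) = 0.
  apply: complexI; rewrite raddf_sum /=.
  transitivity (rho (c, a) (c, a) - sg * rho (c, a) (a, c) - sg * rho (a, c) (c, a)
     + rho (a, c) (a, c)).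
    rewrite /rho /ptr_Y /pure_dm /= !mulr_sumr -!sumrB -big_split /=.
    apply: eq_bigr => b' _; rewrite nrm2E rmorphB /= conjcM sgR mulrBl !mulrBr.
    have -> : sg * psi (a, b', c) * (sg * (psi (a, b', c))^*) =
      psi (a, b', c) * (psi (a, b', c))^* by rewrite mulrACA sg1 mul1r.
    by ring.
  by rewrite (rhoE c a (c, a)) (rhoE a c (a, c)); ring.
apply/eqP; rewrite -subr_eq0 -nrm2_eq0; apply/eqP.
by apply: (psumr_eq0P _ h) => // ? _; apply: nrm2_ge0.
Qed.

Lemma swap_symmetric (d dB : nat) (psi : vec R ('I_d * 'I_dB * 'I_d)%type) :
  supported_sym (ptr_Y (pure_dm psi)) \/ supported_antisym (ptr_Y (pure_dm psi)) ->
  exists sg : C, sg * sg^* = 1 /\ forall a b c, psi (c, b, a) = sg * psi (a, b, c).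
Proof.
case=> supp.
  exists 1; rewrite conjc1 mulr1; split=> //; apply: swap_of_support.
  - exact: conjc1.
  - exact: mulr1.
  - by move=> v a c; rewrite mul1r; apply: supp.
have N1 : (-1 : C)^* = -1 by rewrite rmorphN1.
exists (-1); rewrite N1 mulrNN mulr1; split=> //; apply: swap_of_support => //.
- by rewrite mulrNN mulr1.
- by move=> v a c; rewrite mulN1r; apply: supp.
Qed.

Lemma markov_eigenfam (X Y Z : finType) (mu : mx R (X * Y * Z)%type (X * Y * Z)%type) :
  Defs.markov mu ->
  exists (J : nat) (l r : 'I_J -> nat)
    (W : forall j : 'I_J, mx R Y ('I_(l j) * 'I_(r j))%type)
    (u : forall j, (X * 'I_(l j)) -> vec R (X * 'I_(l j))%type)
    (v : forall j, ('I_(r j) * Z) -> vec R ('I_(r j) * Z)%type)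
    (s : forall j, (X * 'I_(l j)) -> R) (nu : forall j, ('I_(r j) * Z) -> R),
    let g (t : {j : 'I_J & ((X * 'I_(l j)) * ('I_(r j) * Z))%type}) :=
      block_vec (W (tag t)) (u (tag t) (tagged t).1) (v (tag t) (tagged t).2) in
    [/\ (forall j, resolves_id (u j)) /\ (forall j, resolves_id (v j)),
        (forall j i, 0 <= s j i) /\ (forall j, \sum_i s j i <= 1),
        (forall j k, 0 <= nu j k) /\ \sum_j \sum_k nu j k <= 1,
        (forall y y' : Y, \sum_(j < J) mxmul (W j) (adj (W j)) y y' = idmx R y y') &
        resolves_id g /\
        forall t, eigenvec mu (s (tag t) (tagged t).1 * nu (tag t) (tagged t).2) (g t)].
Proof.
move=> [J [l [r [W [p [sigma [tau [[W_iso W_orth] W_id [p0 p1] st muE]]]]]]]].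
have hs j := density_spectral (st j).1.
have ht j := density_spectral (st j).2.
pose Us j := sval (cid (hs j)); pose s j := sval (cid (svalP (cid (hs j)))).
have sE j : [/\ spectral (sigma j) (Us j) (s j), forall z, 0 <= s j z & \sum_z s j z = 1].
  exact: svalP (cid (svalP (cid (hs j)))).
pose Ut j := sval (cid (ht j)); pose t j := sval (cid (svalP (cid (ht j)))).
have tE j : [/\ spectral (tau j) (Ut j) (t j), forall z, 0 <= t j z & \sum_z t j z = 1].
  exact: svalP (cid (svalP (cid (ht j)))).
have u_on j := (unitary_columns (let: And3 sp _ _ := sE j in sp.1)).
have v_on j := (unitary_columns (let: And3 sp _ _ := tE j in sp.1)).
(* The probability p_j is absorbed into the eigenvalues of tau_j. *)
exists J, l, r, W, (fun j i => (Us j)^~ i), (fun j k => (Ut j)^~ k), s, (fun j k => p j * t j k) => g.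
have g_id : resolves_id g.
  move=> w w'; rewrite /g -(sum_sigma (fun j (t : (X * 'I_(l j)) * ('I_(r j) * Z)) =>
    block_vec (W j) ((Us j)^~ t.1) ((Ut j)^~ t.2) w *
    (block_vec (W j) ((Us j)^~ t.1) ((Ut j)^~ t.2) w')^*)).
  transitivity (\sum_j \sum_q W j w.1.2 q * (W j w'.1.2 q)^* * ((w.1.1 == w'.1.1) && (w.2 == w'.2))%:R).
    apply: eq_bigr => j _; rewrite sum_pair.
    have := block_vec_gram (W j) (fun i => (Us j)^~ i) (fun k => (Ut j)^~ k) (fun=> 1) (fun=> 1) w w'.
    under eq_bigr => i _ do under eq_bigr => k _ do rewrite !mul1r.
    move=> ->; apply: eq_bigr => q _.
    under eq_bigr => q' _.
      under eq_bigr => i _ do rewrite mul1r.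
      under [X in _ * (_ * X)]eq_bigr => k _ do rewrite mul1r.
      rewrite (u_on j).2 (v_on j).2 !xpair_eqE -natrM mulnb.
      over.
    rewrite -[RHS](sum_delta (fun q' => W j w.1.2 q * (W j w'.1.2 q')^* * ((w.1.1 == w'.1.1) && (w.2 == w'.2))%:R)).
    apply: eq_bigr => q' _; rewrite -[RHS]mulrA -natrM mulnb; congr (_ * _%:R).
    by case: q q' => [a b] [a' b']; rewrite xpair_eqE /=; do 4 case: eqP.
  transitivity (idmx R w.1.2 w'.1.2 * ((w.1.1 == w'.1.1) && (w.2 == w'.2))%:R).
    rewrite -W_id mulr_suml; apply: eq_bigr => j _.
    by rewrite -mulr_suml.
  case: w w' => [[x y] z] [[x' y'] z']; rewrite /idmx -natrM mulnb !xpair_eqE /=.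
  by do 3 case: eqP.
(* Completeness with unit norms gives orthogonality within and across the blocks at once. *)
have g_on : orthonormal_fam g.
  apply: resolves_unit_orthonormal => // -[j [i k]]; rewrite /g /= block_vec_sqn//.
  by rewrite (orthonormal_sqn i (u_on j).1) (orthonormal_sqn k (v_on j).1) mulr1.
split.
- by split=> j; [exact: (u_on j).2|exact: (v_on j).2].
- by split=> [j|j]; have [_ h1 h2] := sE j => //; rewrite h2.
- split=> [j k|]; first by have [_ h1 _] := tE j; rewrite mulr_ge0.
  rewrite le_eqVlt -p1; apply/orP; left; apply/eqP; apply: eq_bigr => j _.
  by have [_ _ h] := tE j; rewrite -mulr_sumr h mulr1.
- exact: W_id.
split=> // n w.
have muG w1 w2 : mu w1 w2 = \sum_m ((s (tag m) (tagged m).1 * (p (tag m) * t (tag m) (tagged m).2))%:C%C * (g m w1 * (g m w2)^*)).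
  rewrite /g -(sum_sigma (fun j (m : (X * 'I_(l j)) * ('I_(r j) * Z)) =>
    (s j m.1 * (p j * t j m.2))%:C%C *
    (block_vec (W j) ((Us j)^~ m.1) ((Ut j)^~ m.2) w1 *
    (block_vec (W j) ((Us j)^~ m.1) ((Ut j)^~ m.2) w2)^*))).
  transitivity (mu (w1.1.1, w1.1.2, w1.2) (w2.1.1, w2.1.2, w2.2)).
    by case: w1 w2 => [[? ?] ?] [[? ?] ?].
  rewrite muE; apply: eq_bigr => j _; rewrite sum_pair.
  transitivity ((p j)%:C%C * \sum_i \sum_k (s j i)%:C%C * (t j k)%:C%C *
    (block_vec (W j) ((Us j)^~ i) ((Ut j)^~ k) w1 *
    (block_vec (W j) ((Us j)^~ i) ((Ut j)^~ k) w2)^*)); last first.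
    rewrite mulr_sumr; apply: eq_bigr => i _; rewrite mulr_sumr; apply: eq_bigr => k _.
    by rewrite /= !rmorphM /= -!mulrA mulrCA.
  rewrite (block_vec_gram (W j) (fun i => (Us j)^~ i) (fun k => (Ut j)^~ k)
     (fun i => (s j i)%:C%C) (fun k => (t j k)%:C%C)).
  congr (_ * _); rewrite sum_pair; apply: eq_bigr => a _; apply: eq_bigr => b _.
  rewrite sum_pair; apply: eq_bigr => a' _; apply: eq_bigr => b' _ /=.
  have [sp _ _] := sE j; have [tp _ _] := tE j.
  rewrite {1}sp.2 {1}tp.2 /diag_conj.
  have -> : \sum_z Us j (w1.1.1, a) z * (s j z)%:C%C * (Us j (w2.1.1, a') z)^*%C =
     \sum_i (s j i)%:C%C * Us j (w1.1.1, a) i * (Us j (w2.1.1, a') i)^*.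
    by apply: eq_bigr => z _; rewrite [Us j _ z * _]mulrC.
  have -> : \sum_z Ut j (b, w1.2) z * (t j z)%:C%C * (Ut j (b', w2.2) z)^*%C =
     \sum_i (t j i)%:C%C * Ut j (b, w1.2) i * (Ut j (b', w2.2) i)^*.
    by apply: eq_bigr => z _; rewrite [Ut j _ z * _]mulrC.
  by ring.
rewrite /apply; under eq_bigr => w2 _ do rewrite muG mulr_suml.
rewrite exchange_big /= (bigD1 n)//= [X in _ + X]big1 ?addr0.
  transitivity ((s (tag n) (tagged n).1 * (p (tag n) * t (tag n) (tagged n).2))%:C%C * g n w * dot (g n) (g n)).
    by rewrite /dot mulr_sumr; apply: eq_bigr => w2 _; ring.
  by rewrite g_on eqxx mulr1.
move=> m /negbTE mn.
transitivity ((s (tag m) (tagged m).1 * (p (tag m) * t (tag m) (tagged m).2))%:C%C * g m w * dot (g m) (g n)).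
  by rewrite /dot mulr_sumr; apply: eq_bigr => w2 _; ring.
by rewrite g_on mn mulr0.
Qed.

End MarkovSpectrum.

(** * The lower bound *)

Section Bounds.
Variable R : realType.
Local Notation C := R[i].
Local Notation "z ^*" := (conjc z) : ring_scope.

Lemma normalized_sqn (T : finType) (psi : vec R T) : normalized psi -> sqn psi = 1.
Proof.
move=> h; apply: complexI; rewrite sqnE -[RHS]h; apply: eq_bigr => x _; exact: mulrC.
Qed.

Lemma ptr_YZ_density (X Y Z : finType) (psi : vec R (X * Y * Z)%type) :
  normalized psi -> density (ptr_YZ (pure_dm psi)).
Proof.
move=> /normalized_sqn psi1.
rewrite (_ : ptr_YZ _ = fun x x' => \sum_(q : Y * Z) psi (x, q.1, q.2) * (psi (x', q.1, q.2))^*).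
  apply: (gram_density (F := fun q : Y * Z => fun x => psi (x, q.1, q.2))).
  rewrite -psi1 /sqn exchange_big !sum_pair; apply: eq_bigr => x _ /=.
  by rewrite sum_pair.
by apply/funext => x; apply/funext => x'; rewrite sum_pair.
Qed.

(** A pure state is its own eigenvector with eigenvalue 1, so log rho kills [phi] and only the term
    in log mu remains. *)
Lemma rel_entropy_value (T : finType) (phi : vec R T) (L1 L2 : mx R T T) :
  sqn phi = 1 -> fcalc (@slog2 R) (pure_dm phi) L1 ->
  complex.Re (trace (mxmul (pure_dm phi) (fun x y => L1 x y - L2 x y))) =
  - complex.Re (dot phi (apply L2 phi)).
Proof.
move=> phi1 f1; rewrite trace_pure.
have e1 : eigenvec (pure_dm phi) 1 phi.
  move=> x; rewrite mul1r /apply /pure_dm.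
  transitivity (phi x * dot phi phi).
    by rewrite /dot mulr_sumr; apply: eq_bigr => y _; rewrite mulrA.
  by rewrite -sqnE phi1 mulr1.
have L1phi := fcalc_eigenvec f1 e1.
have -> : apply (fun x y => L1 x y - L2 x y) phi = fun x => - apply L2 phi x.
  apply/funext => x; rewrite /apply.
  under eq_bigr => y _ do rewrite mulrBl.
  rewrite sumrB -/(apply L1 phi x) L1phi slog2E ln1 mul0r.
  by rewrite mul0r sub0r.
rewrite /dot; under eq_bigr => x _ do rewrite mulrN.
by rewrite sumrN raddfN.
Qed.

Lemma vN_entropy_le_Delta (d dB : nat) (psi : vec R ('I_d * 'I_dB * 'I_d)%type) :
  normalized psi ->
  supported_sym (ptr_Y (pure_dm psi)) \/ supported_antisym (ptr_Y (pure_dm psi)) ->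
  (vN_entropy (ptr_YZ (pure_dm psi)) <= Delta psi)%E.
Proof.
move=> psi_n /swap_symmetric [sg [sg1 swap]].
have psi1 := normalized_sqn psi_n.
have [H [lam [sp lam0 lam1]]] := density_spectral (ptr_YZ_density psi_n).
rewrite (vN_entropy_spectral sp).
apply: le_ereal_inf_tmp => _ [nA [nB [nC [VA [VB [VC [mu [hA hB hC [_ mmu] ->]]]]]]]].
apply: le_ereal_inf_tmp => _ /= [[_ ->]|[supp [L1 [L2 [f1 [f2 ->]]]]]]; first exact: leey.
rewrite lee_fin; set phi := embed3 VA VB VC psi in supp f1 *.
have phi1 : sqn phi = 1 by rewrite embed3_sqn.
rewrite (rel_entropy_value L2 phi1 f1) mulNr lerN2.
have [J [l [r [W [u [v [s [nu [[u_id v_id] [s0 s1] [nu0 nu1] W_id [g_id g_eig]]]]]]]]]] :=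
  markov_eigenfam mmu.
pose g (t : {j : 'I_J & (('I_nA * 'I_(l j)) * ('I_(r j) * 'I_nC))%type}) :=
  block_vec (W (tag t)) (u (tag t) (tagged t).1) (v (tag t) (tagged t).2).
have {}g_id : resolves_id g := g_id.
have {}g_eig t : eigenvec mu (s (tag t) (tagged t).1 * nu (tag t) (tagged t).2) (g t) := g_eig t.
rewrite (dot_apply_eigenfam phi g_id (fun t => fcalc_eigenvec f2 (g_eig t))) /=.
(* An eigenvector of eigenvalue 0 lies in the kernel of [mu], hence in that of the pure state, so it
   is orthogonal to [phi]. *)
have g_supp t : s (tag t) (tagged t).1 * nu (tag t) (tagged t).2 = 0 -> nrm2 (dot (g t) phi) = 0.
  move=> k0; have := supp (g t).
  have -> : apply mu (g t) = (fun=> 0).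
    by apply/funext => x; rewrite g_eig k0 mul0r.
  move=> /(_ erefl) h; apply: complexI; rewrite nrm2E dotC.
  transitivity (dot (g t) (apply (pure_dm phi) (g t))).
    rewrite [dot (g t) phi]/dot mulr_suml; apply: eq_bigr => x _; rewrite -mulrA; congr (_ * _).
    rewrite /apply /pure_dm /dot mulr_sumr; apply: eq_bigr => y _; exact: mulrA.
  by rewrite h /dot big1// => x _; rewrite mulr0.
under eq_bigr => t _ do rewrite slog2E mulrAC.
rewrite -mulr_suml ler_pM2r ?invr_gt0 ?ln_gt0 ?ltr1n//.
have [h_on h_id] := unitary_columns sp.1.
pose uA j i : vec R ('I_d * 'I_(l j))%type := fun q => \sum_x (VA x q.1)^* * u j i (x, q.2).
pose vC j k : vec R ('I_(r j) * 'I_d)%type := fun q => \sum_z (VC z q.2)^* * v j k (q.1, z).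
pose G j (a : 'I_(l j)) (b : 'I_(r j)) y := \sum_y' (W j y' (a, b))^* * VB y' y.
have rho a a' : \sum_b \sum_c psi (a, b, c) * (psi (a', b, c))^* =
    \sum_e (lam e)%:C%C * H a e * (H a' e)^*.
  have := congr1 (fun F => F a a') sp.2; rewrite /ptr_YZ /pure_dm /diag_conj => ->.
  by apply: eq_bigr => e _; rewrite [H a e * _]mulrC.
(* The columns of all the W_j together resolve the identity, so Parseval applied to the isometric
   image VB chi gives its norm. *)
have G_iso (chi : vec R 'I_dB) :
    \sum_j \sum_a \sum_b nrm2 (\sum_y G j a b y * chi y) = sqn chi.
  rewrite -(isometry_sqn chi hB).
  pose wf (t : {j : 'I_J & ('I_(l j) * 'I_(r j))%type}) : vec R 'I_nB := fun y => W (tag t) y (tagged t).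
  have wf_id : resolves_id wf.
    move=> y y'; rewrite /wf -(sum_sigma (fun j t => W j y t * (W j y' t)^*)).
    exact: W_id.
  rewrite -[RHS](parseval (fun y => \sum_x VB y x * chi x) wf_id).
  rewrite -(sum_sigma (fun j t => nrm2 (dot (fun y => W j y t) (fun y => \sum_x VB y x * chi x)))).
  apply: eq_bigr => j _; rewrite sum_pair; apply: eq_bigr => a _; apply: eq_bigr => b _.
  congr nrm2; rewrite /G /dot; under eq_bigr => y _ do rewrite mulr_suml.
  rewrite exchange_big; apply: eq_bigr => y' _ /=; rewrite mulr_sumr.
  by apply: eq_bigr => y _; rewrite mulrA.
have dotE j i k : dot (block_vec (W j) (u j i) (v j k)) phi =
    dot (vC j k) (fun w => dot (uA j i) (fun x =>
      \sum_b G j x.2 w.1 b * psi (x.1, b, w.2))).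
  exact: dot_block_vec_embed3.
apply: le_trans (entropy_le_block_divergence sg1 swap h_on h_id rho lam1 G_iso
  (fun j => resolves_pullbackl hA (u_id j)) (fun j => resolves_pullbackr hC (v_id j))
  s0 s1 nu0 nu1 _); last first.
  move=> j i k k0; have := g_supp (Tagged (fun j => (('I_nA * 'I_(l j)) * ('I_(r j) * 'I_nC))%type) (i, k)) k0.
  by rewrite /g /= dotE.
rewrite le_eqVlt; apply/orP; left; apply/eqP.
rewrite /g -(sum_sigma (fun j (t : ('I_nA * 'I_(l j)) * ('I_(r j) * 'I_nC)) =>
  ln (s j t.1 * nu j t.2) * nrm2 (dot (block_vec (W j) (u j t.1) (v j t.2)) phi))).
apply: eq_bigr => j _; rewrite sum_pair; apply: eq_bigr => i _; apply: eq_bigr => k _.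
by rewrite /= dotE mulrC.
Qed.

End Bounds.

(** * The product state *)

Section UpperBound.
Variable R : realType.
Local Notation C := R[i].
Local Notation "z ^*" := (conjc z) : ring_scope.

Lemma sum_deltal (T : finType) (F : T -> C) (x : T) :
  \sum_y (x == y)%:R * F y = F x.
Proof. by rewrite -[RHS](sum_delta F); apply: eq_bigr => y _; rewrite mulrC. Qed.

Lemma conjc_bool (b : bool) : (b%:R : C)^* = b%:R.
Proof. by case: b; rewrite ?conjc1 ?conjc0. Qed.

Lemma isometry_idmx (T : finType) : Defs.isometry (@idmx R T).
Proof.
apply/funext => x; apply/funext => y; rewrite /mxmul /adj /idmx.
under eq_bigr do rewrite conjc_bool eq_sym.
exact: sum_deltal.
Qed.

Lemma embed3_idmx (X Y Z : finType) (psi : vec R (X * Y * Z)%type) :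
  embed3 (@idmx R X) (@idmx R Y) (@idmx R Z) psi = psi.
Proof.
apply/funext => -[[x y] z]; rewrite /embed3 /idmx /=.
transitivity (\sum_x' (x == x')%:R * \sum_y' (y == y')%:R * \sum_z' (z == z')%:R * psi (x', y', z')).
  apply: eq_bigr => x' _; rewrite mulr_sumr; apply: eq_bigr => y' _.
  by rewrite !mulr_sumr; apply: eq_bigr => z' _; rewrite !mulrA.
by rewrite !sum_deltal.
Qed.

Lemma dot_apply_hermitian (T : finType) (A : mx R T T) (u v : vec R T) :
  Defs.hermitian A -> dot (apply A u) v = dot u (apply A v).
Proof.
move=> hA; rewrite /dot /apply.
under eq_bigr => x _ do rewrite conjc_sum mulr_suml.
rewrite exchange_big; apply: eq_bigr => y _ /=; rewrite mulr_sumr.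
by apply: eq_bigr => x _; rewrite conjcM -hA; ring.
Qed.

Section ProductState.
Variables (a b c : nat) (psi : vec R ('I_a * 'I_b * 'I_c)%type).
Hypothesis psi_n : normalized psi.

Let rhoA := ptr_YZ (pure_dm psi).

Definition ptr_X_pure : mx R ('I_b * 'I_c)%type ('I_b * 'I_c)%type :=
  fun q q' => \sum_x psi (x, q.1, q.2) * (psi (x, q'.1, q'.2))^*.

Definition product_state : mx R ('I_a * 'I_b * 'I_c)%type ('I_a * 'I_b * 'I_c)%type :=
  fun w w' => rhoA w.1.1 w'.1.1 * ptr_X_pure (w.1.2, w.2) (w'.1.2, w'.2).

Let rhoAE x x' : rhoA x x' = \sum_(q : 'I_b * 'I_c) psi (x, q.1, q.2) * (psi (x', q.1, q.2))^*.
Proof. by rewrite sum_pair. Qed.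

Let sum_nrm2 : \sum_x \sum_y \sum_z nrm2 (psi (x, y, z)) = 1.
Proof. by rewrite -(normalized_sqn psi_n) /sqn !sum_pair. Qed.

Lemma ptr_X_pure_density : density ptr_X_pure.
Proof.
apply: (gram_density (F := fun x => fun q : 'I_b * 'I_c => psi (x, q.1, q.2))).
by rewrite -sum_nrm2; apply: eq_bigr => x _; rewrite /sqn sum_pair.
Qed.

(** The Gram vectors are products of two copies of psi: one traced over B C, the other over A, which
    explains the index type of [n]. *)
Lemma product_state_density : density product_state.
Proof.
rewrite (_ : product_state = fun w w' => \sum_(n : ('I_b * 'I_c) * 'I_a)
    (psi (w.1.1, n.1.1, n.1.2) * psi (n.2, w.1.2, w.2)) *
    (psi (w'.1.1, n.1.1, n.1.2) * psi (n.2, w'.1.2, w'.2))^*).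
  apply: (gram_density (F := fun (n : ('I_b * 'I_c) * 'I_a) => fun (w : 'I_a * 'I_b * 'I_c) =>
     psi (w.1.1, n.1.1, n.1.2) * psi (n.2, w.1.2, w.2))).
  transitivity ((\sum_x \sum_y \sum_z nrm2 (psi (x, y, z))) * \sum_x \sum_y \sum_z nrm2 (psi (x, y, z))); last first.
    by rewrite sum_nrm2 mulr1.
  rewrite !sum_pair.
  transitivity (\sum_y \sum_z \sum_x' \sum_x nrm2 (psi (x, y, z)) * \sum_y' \sum_z' nrm2 (psi (x', y', z'))).
    do 3 (apply: eq_bigr => ? _); rewrite /sqn !sum_pair; apply: eq_bigr => x _.
    rewrite mulr_sumr; apply: eq_bigr => y' _; rewrite mulr_sumr.
    by apply: eq_bigr => z' _; rewrite nrm2M.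
  rewrite mulr_suml.
  transitivity (\sum_x \sum_y \sum_z \sum_x' nrm2 (psi (x, y, z)) * \sum_y' \sum_z' nrm2 (psi (x', y', z'))).
    rewrite [RHS]exchange_big; apply: eq_bigr => y _ /=.
    rewrite [RHS]exchange_big; apply: eq_bigr => z _ /=; exact: exchange_big.
  apply: eq_bigr => x _; rewrite mulr_suml; apply: eq_bigr => y _.
  by rewrite mulr_suml; apply: eq_bigr => z _; rewrite mulr_sumr.
apply/funext => w; apply/funext => w'; rewrite /product_state rhoAE /ptr_X_pure.
rewrite [RHS]sum_pair mulr_suml; apply: eq_bigr => q _; rewrite mulr_sumr.
by apply: eq_bigr => x _; rewrite conjcM /=; ring.
Qed.

Lemma product_state_markov : Defs.markov product_state.
Proof.
(* A single block with b^L one-dimensional and b^R = B; then sigma is rho_A and tau is rho_BC. *)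
exists 1, (fun=> 1), (fun=> b), (fun=> fun y q => (y == q.2)%:R), (fun=> 1),
  (fun=> fun q q' => rhoA q.1 q'.1), (fun=> ptr_X_pure); split.
- split=> [j|j k]; last by rewrite !ord1 eqxx.
  apply/funext => -[i q]; apply/funext => -[i' q']; rewrite /mxmul /adj /idmx /=.
  under eq_bigr do rewrite conjc_bool eq_sym.
  by rewrite sum_deltal xpair_eqE !ord1.
- move=> y y'; rewrite big_ord1 /mxmul /adj /idmx sum_pair big_ord1 /=.
  by rewrite sum_deltal conjc_bool eq_sym.
- by split; rewrite ?big_ord1.
- move=> j; split; last exact: ptr_X_pure_density.
  rewrite (_ : (fun q q' => _) = fun q q' : 'I_a * 'I_1 => \sum_(n : 'I_b * 'I_c)
    psi (q.1, n.1, n.2) * (psi (q'.1, n.1, n.2))^*).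
    apply: (gram_density (F := fun (n : 'I_b * 'I_c) => fun (q : 'I_a * 'I_1) => psi (q.1, n.1, n.2))).
    rewrite /sqn exchange_big sum_pair -sum_nrm2; apply: eq_bigr => x _.
    by rewrite big_ord1 sum_pair.
  by apply/funext => q; apply/funext => q'; rewrite rhoAE.
move=> x x' y y' z z'; rewrite !big_ord1 mul1r.
under eq_bigr => k _.
  rewrite big_ord1.
  under eq_bigr => k' _ do rewrite /= conjc_bool.
  rewrite sum_delta.
  over.
under eq_bigr => k _ do rewrite /= -!mulrA.
by rewrite sum_deltal.
Qed.

End ProductState.

Lemma Delta_le_double_entropy (a b c : nat) (psi : vec R ('I_a * 'I_b * 'I_c)%type) :
  normalized psi ->
  (Delta psi <= 2%:E * vN_entropy (ptr_YZ (pure_dm psi)))%E.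
Proof.
move=> psi_n; have psi1 := normalized_sqn psi_n.
have [H [lam [spA lam0 lam1]]] := density_spectral (ptr_YZ_density psi_n).
have [K [kap [spB kap0 kap1]]] := density_spectral (ptr_X_pure_density psi_n).
rewrite (vN_entropy_spectral spA) -EFinM.
set mu := product_state psi.
have mu_d : density mu by apply: product_state_density.
have [H_on H_id] := unitary_columns spA.1.
have [K_on K_id] := unitary_columns spB.1.
pose g (n : 'I_a * ('I_b * 'I_c)) : vec R ('I_a * 'I_b * 'I_c)%type :=
  fun w => H w.1.1 n.1 * K (w.1.2, w.2) n.2.
have g_id : resolves_id g.
  move=> [[x y] z] [[x' y'] z']; rewrite /g sum_pair /=.
  transitivity ((\sum_i H x i * (H x' i)^*) * (\sum_k K (y, z) k * (K (y', z') k)^*)).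
    rewrite mulr_suml; apply: eq_bigr => i _; rewrite mulr_sumr.
    by apply: eq_bigr => k _; rewrite conjcM; ring.
  by rewrite H_id K_id -natrM mulnb !xpair_eqE andbA.
have g_eig n : eigenvec mu (lam n.1 * kap n.2) (g n).
  move=> [[x y] z].
  transitivity (apply (ptr_YZ (pure_dm psi)) (H^~ n.1) x * apply (ptr_X_pure psi) (K^~ n.2) (y, z)).
    rewrite /apply mulr_suml !sum_pair; apply: eq_bigr => x' _.
    rewrite mulr_sumr; apply: eq_bigr => y' _.
    rewrite mulr_sumr; apply: eq_bigr => z' _.
    by rewrite /mu /product_state /g /=; ring.
  rewrite (spectral_eigenvec n.1 spA) (spectral_eigenvec n.2 spB) rmorphM /g /=.
  by ring.
pose psiH i : vec R ('I_b * 'I_c)%type := fun q => dot (H^~ i) (fun x => psi (x, q.1, q.2)).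
have spec x x' : \sum_(q : 'I_b * 'I_c) psi (x, q.1, q.2) * (psi (x', q.1, q.2))^* =
    \sum_i (lam i)%:C%C * H x i * (H x' i)^*.
  have := congr1 (fun F => F x x') spA.2; rewrite /ptr_YZ /pure_dm /diag_conj sum_pair => ->.
  by apply: eq_bigr => i _; rewrite [H x i * _]mulrC.
have psiH_sqn i : sqn (psiH i) = lam i.
  rewrite /sqn /psiH (reduced_weight (Psi := fun (q : 'I_b * 'I_c) x => psi (x, q.1, q.2)) _ spec).
  rewrite (bigD1 i)//= big1 ?addr0.
    by have := H_on i i; rewrite eqxx => ->; rewrite /nrm2 /= expr1n expr0n addr0 mulr1.
  by move=> k /negbTE ki; have := H_on i k; rewrite eq_sym ki => ->; rewrite nrm20 mulr0.
(* The Schmidt decomposition: contracting psi with an eigenvector of rho_A gives an eigenvector of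
   rho_BC for the same eigenvalue. *)
have psiH_eig i : eigenvec (ptr_X_pure psi) (lam i) (psiH i).
  move=> q.
  transitivity (\sum_x psi (x, q.1, q.2) * (apply (ptr_YZ (pure_dm psi)) (H^~ i) x)^*).
    rewrite /apply /ptr_X_pure.
    under eq_bigr => q' _ do rewrite mulr_suml.
    rewrite exchange_big; apply: eq_bigr => x _ /=.
    rewrite conjc_sum mulr_sumr.
    transitivity (\sum_q' \sum_x' psi (x, q.1, q.2) * (psi (x, q'.1, q'.2))^* * ((H x' i)^* * psi (x', q'.1, q'.2))).
      by apply: eq_bigr => q' _; rewrite /psiH /dot mulr_sumr.
    rewrite exchange_big; apply: eq_bigr => x' _ /=.
    rewrite conjcM /ptr_YZ /pure_dm conjc_sum mulr_suml mulr_sumr sum_pair.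
    apply: eq_bigr => y _; rewrite conjc_sum mulr_suml mulr_sumr; apply: eq_bigr => z _ /=.
    by rewrite conjcM conjcK; ring.
  rewrite /psiH /dot mulr_sumr; apply: eq_bigr => x _.
  by rewrite (spectral_eigenvec i spA) conjcM conjc_real; ring.
have g_dot n : dot (g n) psi = dot (K^~ n.2) (psiH n.1).
  rewrite /dot /psiH !sum_pair.
  under [RHS]eq_bigr => y _ do under eq_bigr => z _ do rewrite /dot mulr_sumr.
  under [RHS]eq_bigr => y _ do rewrite exchange_big /=.
  rewrite [RHS]exchange_big; apply: eq_bigr => x _ /=.
  apply: eq_bigr => y _; apply: eq_bigr => z _.
  by rewrite /g conjcM /=; ring.
(* Therefore psi only overlaps with products H_i (x) K_k whose two eigenvalues coincide and are
   positive. *)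
have w_eig n : dot (g n) psi != 0 -> kap n.2 = lam n.1 /\ 0 < lam n.1.
  rewrite g_dot => dN0; split; first exact: (spectral_coef spB (psiH_eig n.1) dN0).
  rewrite lt_def lam0 andbT; apply: contra_neq dN0 => l0.
  apply/eqP; rewrite -nrm2_eq0 eq_le nrm2_ge0 andbT -l0 -psiH_sqn -(parseval _ K_id).
  by rewrite (bigD1 n.2)//= lerDl sumr_ge0// => k _; apply: nrm2_ge0.
(* If mu v = 0, each [g n] overlapping with psi has eigenvalue lam^2 > 0 and so is orthogonal to v;
   by Parseval psi is orthogonal to v. *)
have psi_supp : supp_le (pure_dm psi) mu.
  move=> v mv0; apply/funext => x.
  transitivity (psi x * dot psi v).
    by rewrite /dot mulr_sumr; apply: eq_bigr => y _; rewrite mulrA.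
  rewrite -(parseval_dot psi v g_id) big1 ?mulr0// => n _.
  have [->|/w_eig[kl l0]] := eqVneq (dot (g n) psi) 0; first by rewrite conjc0 mul0r.
  have : dot (apply mu (g n)) v = 0.
    by rewrite (dot_apply_hermitian _ _ mu_d.1.1) mv0 /dot big1// => y _; rewrite mulr0.
  have -> : dot (apply mu (g n)) v = (lam n.1 * kap n.2)%:C%C * dot (g n) v.
    by rewrite /dot mulr_sumr; apply: eq_bigr => y _; rewrite g_eig conjcM conjc_real mulrA.
  move=> /eqP; rewrite mulf_eq0 kl => /orP[/eqP h|/eqP ->]; last by rewrite mulr0.
  by have := mulr_gt0 l0 l0; rewrite (complexI h : lam n.1 * lam n.1 = 0) ltxx.
have [U1 [l1 sp1]] : exists U l, spectral (pure_dm psi) U l.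
  by apply: hermitian_spectral => x y; rewrite /pure_dm conjcM conjcK mulrC.
have [U2 [l2 sp2]] := hermitian_spectral mu_d.1.1.
have f1 : fcalc (@slog2 R) (pure_dm psi) (diag_conj U1 (@slog2 R \o l1)) by exists U1, l1.
have f2 : fcalc (@slog2 R) mu (diag_conj U2 (@slog2 R \o l2)) by exists U2, l2.
apply: (@le_trans _ _ (rel_entropy (pure_dm psi) mu)).
  apply: ereal_inf_lbound => /=.
  exists a, b, c, (@idmx R _), (@idmx R _), (@idmx R _), mu.
  rewrite embed3_idmx; split=> //; do ?exact: isometry_idmx.
  by split=> //; apply: product_state_markov.
apply: ereal_inf_lbound => /=; right; split=> //.
exists (diag_conj U1 (@slog2 R \o l1)), (diag_conj U2 (@slog2 R \o l2)); split=> //; split=> //.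
congr EFin; rewrite (rel_entropy_value _ psi1 f1).
rewrite (dot_apply_eigenfam psi g_id (fun n => fcalc_eigenvec f2 (g_eig n))) /=.
rewrite mulNr mulrN; congr (- _); rewrite mulrA mulr_sumr mulr_suml sum_pair.
apply: eq_bigr => i _.
transitivity (\sum_k 2 * ln (lam i) / ln 2 * nrm2 (dot (K^~ k) (psiH i))).
  by rewrite -mulr_sumr parseval// psiH_sqn; ring.
apply: eq_bigr => k _; rewrite g_dot /= slog2E.
(* Where the weight is nonzero, log(lam kap) = 2 log lam, which is the source of the factor 2. *)
have [->|dN0] := eqVneq (dot (K^~ k) (psiH i)) 0; first by rewrite nrm20 !mulr0.
have := w_eig (i, k); rewrite g_dot => /(_ dN0) /= [-> l0].
by rewrite lnM ?posrE// mulr2n mulrDl mul1r.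
Qed.

End UpperBound.

Theorem theorem5 (R : realType) (d dB : nat)
    (psi : vec R ('I_d * 'I_dB * 'I_d)%type) :
  normalized psi ->
  supported_sym (ptr_Y (pure_dm psi)) \/ supported_antisym (ptr_Y (pure_dm psi)) ->
  (vN_entropy (ptr_YZ (pure_dm psi)) <= Delta psi <=
     2%:E * vN_entropy (ptr_YZ (pure_dm psi)))%E.
Proof.
move=> psi_n supp; apply/andP; split; first exact: vN_entropy_le_Delta.
exact: Delta_le_double_entropy.
Qed.
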